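(* Let $k=2m>l=2h\ge 0$ be (even) integers and $N>2k$. Then there exist $k$ positive constants $C_{k,l}^i$ ($i=1,\dots,k$) such that for all $u\in C_c^\infty(\mathbb{H}^N\setminus\{o\})$ $$\int_{\mathbb{H}^N}(\Delta_r^m u)^2\,dv_{\mathbb{H}^N}-\Big(\frac{N-1}{2}\Big)^{4(m-h)}\int_{\mathbb{H}^N}(\Delta_r^h u)^2\,dv_{\mathbb{H}^N}\ \ge\ \sum_{i=1}^{k}C_{k,l}^i\int_{\mathbb{H}^N}\frac{u^2}{r^{2i}}\,dv_{\mathbb{H}^N},$$ where $C_{k,l}^k=C_{k-l,0}^{k-l}\,\Xi_{2(k-l),\,l/2}^{0}$ and $C_{k,l}^1=C_{k-l,0}^{1}\,\Xi_{2,\,l/2}^{l}$, with the quantities $C_{n,0}^{n}$, $C_{n,0}^{1}$, $\Xi_{\alpha,\beta}^{0}$, $\Xi_{\alpha,\beta}^{2\beta}$ given by the explicit formulas in the context.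
   Context: $\mathbb{H}^N$ is the $N$-dimensional hyperbolic space with a fixed pole $o$. In geodesic polar coordinates $x=(r,\sigma)\in(0,\infty)\times\mathbb{S}^{N-1}$ about $o$, with $r$ the geodesic distance from $x$ to $o$, the metric is $dr^2+\sinh^2 r\,d\omega^2$ and $dv_{\mathbb{H}^N}=(\sinh r)^{N-1}\,dr\,d\sigma$ is the volume element. The radial Laplacian is $\Delta_r u=\frac{\partial^2u}{\partial r^2}+(N-1)\coth r\,\frac{\partial u}{\partial r}$, and $\Delta_r^j$ is its $j$-th iterate ($\Delta_r^0u=u$). The constants depend only on $N,k,l,i$, not on $u$. Explicit quantities (empty sums are $0$, empty products are $1$). For a positive integer $n$: $$C_{n,0}^n=\begin{cases}\big(\frac{N-4}{2^{2p}}\big)^2\prod_{j=1}^{p-1}(N+4j)^2(N-4j-4)^2 & n=2p,\\ \frac{1}{2^{4p+2}}\prod_{j=1}^{p}(N+4j-2)^2(N-4j-2)^2 & n=2p+1,\end{cases}$$ $$C_{n,0}^1=\begin{cases}\frac{N(N-1)}{2^{4p}}\sum_{j=1}^{p}(N-1)^{4p-2j-2} & n=2p,\\ \frac{N(N-1)}{2^{4p+2}}\sum_{j=1}^{p}(N-1)^{2p+2j-2}+\frac{(N-1)^{2p}}{2^{4p+2}} & n=2p+1.\end{cases}$$ For $\alpha\ge0$ and an integer $\beta\ge1$: $$\Xi_{\alpha,\beta}^0=\prod_{j=0}^{\beta-1}\frac{(N+\alpha+4j)^2(N-\alpha-4j-4)^2}{16},\qquad \Xi_{\alpha,\beta}^{2\beta}=\Big(\frac{N-1}{4}\Big)^{2\beta},$$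 and $\Xi_{\alpha,0}^0=1$. *)

(* Defs.v *)
From HB Require Import structures.
From mathcomp Require Import all_boot all_order all_algebra.
From mathcomp Require Import all_classical all_reals all_analysis.
From mathcomp Require Import measurable_realfun.

Set Implicit Arguments.
Unset Strict Implicit.
Unset Printing Implicit Defensive.
Import Order.TTheory GRing.Theory Num.Theory.
Import numFieldNormedType.Exports.

Local Open Scope classical_set_scope.
Local Open Scope ring_scope.

Section euclidean_measure.
Context {R : realType}.
Local Notation tup n := (n.-tuple (measurableTypeR R)).

Definition tuple_cons n (p : measurableTypeR R * tup n) : tup n.+1 :=
  [the n.+1.-tuple _ of p.1 :: p.2].

Lemma measurable_tuple_cons n : measurable_fun [set: _] (@tuple_cons n).
Proof. exact: measurable_cons. Qed.

(* [\x^] is the product measure, in the variant that only requires the first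
   factor to be known to be sigma-finite. *)
Fixpoint lebesgue_tuple n : set (tup n) -> \bar R :=
  match n with
  | 0 => \d_ ([tuple] : tup 0)
  | n'.+1 => pushforward (lebesgue_measure \x^ @lebesgue_tuple n')%E
               (@tuple_cons n')
  end.
Arguments lebesgue_tuple : clear implicits.

Lemma lebesgue_tuple_measure n :
  exists mu : {measure set (tup n) -> \bar R}, lebesgue_tuple n = mu.
Proof.
elim: n => [|n [mu IH]]; first by exists (\d_ ([tuple] : tup 0)).
exists (measure_function_pushforward__canonical__measure_function_Measure
  (lebesgue_measure \x^ mu)%E (@measurable_tuple_cons n)).
by rewrite /= IH.
Qed.

Section lebesgue_tuple_instance.
Variable n : nat.

Let lebesgue_tuple0 : lebesgue_tuple n set0 = 0%E.
Proof. by have [mu ->] := lebesgue_tuple_measure n; exact: measure0. Qed.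

Let lebesgue_tuple_ge0 A : (0 <= lebesgue_tuple n A)%E.
Proof. by have [mu ->] := lebesgue_tuple_measure n; exact: measure_ge0. Qed.

Let lebesgue_tuple_sigma_additive : semi_sigma_additive (lebesgue_tuple n).
Proof.
have [mu ->] := lebesgue_tuple_measure n.
exact: measure_semi_sigma_additive.
Qed.

HB.instance Definition _ := isMeasure.Build _ _ _ (lebesgue_tuple n)
  lebesgue_tuple0 lebesgue_tuple_ge0 lebesgue_tuple_sigma_additive.

End lebesgue_tuple_instance.

Definition enorm n (x : tup n) : R := Num.sqrt (\sum_(i < n) tnth x i ^+ 2).

Definition normalize n (x : tup n) : tup n :=
  [tuple tnth x i / enorm x | i < n].

Definition punctured_ball n : set (tup n) := [set x | 0 < enorm x <= 1].
Arguments punctured_ball : clear implicits.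

(* Surface measure of the unit sphere of R^n, as a measure on R^n carried by the
   sphere: n times the Lebesgue measure of the cone in the unit ball. *)
Definition sphere_measure n (A : set (tup n)) : \bar R :=
  (n%:R%:E * lebesgue_tuple n (punctured_ball n `&` @normalize n @^-1` A))%E.
Arguments sphere_measure : clear implicits.

Lemma measurable_enorm n : measurable_fun [set: tup n] (@enorm n).
Proof.
have msqrt : measurable_fun [set: R] (@Num.sqrt R).
  by apply: continuous_measurable_fun; exact: sqrt_continuous.
apply: (measurableT_comp msqrt).
apply: measurable_sum => i.
by apply: measurable_funX; exact: measurable_tnth.
Qed.

Lemma measurable_normalize n : measurable_fun [set: tup n] (@normalize n).
Proof.
apply/measurable_fun_tnthP => i.
rewrite (_ : _ \o _ = (fun x => tnth x i) \* (fun x => enorm x `^ (-1))).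
  apply: measurable_funM; first exact: measurable_tnth.
  exact: (measurableT_comp (measurable_powR (-1)) (@measurable_enorm n)).
apply/funext => x /=.
by rewrite tnth_mktuple powR_inv1// sqrtr_ge0.
Qed.

Lemma measurable_punctured_ball n : measurable (punctured_ball n).
Proof.
rewrite (_ : punctured_ball n = @enorm n @^-1` `]0, 1]%classic).
  rewrite -[X in measurable X]setTI; apply: measurable_enorm => //.
by apply/seteqP; split => x /=; rewrite in_itv.
Qed.

Definition cube n : set (tup n) := [set x | forall i, `|tnth x i| <= 1].
Arguments cube : clear implicits.

Lemma measurable_cube n : measurable (cube n).
Proof.
rewrite (_ : cube n = \bigcap_(i in [set: 'I_n])
   ((fun x : tup n => tnth x i) @^-1` `[-1, 1]%classic)).
  apply: fin_bigcap_measurable => // i _.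
  by rewrite -[X in measurable X]setTI; apply: measurable_tnth.
apply/seteqP; split => x /=.
  by move=> h i _ /=; rewrite in_itv/= -ler_norml.
by move=> h i; have := h i I; rewrite /= in_itv/= -ler_norml.
Qed.

Lemma lebesgue_tuple_cube n : (lebesgue_tuple n (cube n) < +oo)%E.
Proof.
elim: n => [|n IH]; first by rewrite /= diracE ltry.
rewrite /= /pushforward.
rewrite (_ : _ @^-1` _ = `[-1, 1]%classic `*` cube n).
  rewrite product_measure2E//; last exact: measurable_cube.
  apply: lte_mul_pinfty => //.
  have /= -> := @lebesgue_measure_itv R `[-1, 1].
  by case: ifP.
apply/seteqP; split => -[a x] /=; rewrite in_itv/= -ler_norml.
  move=> h; split; first by have := h ord0.
  by move=> i; have := h (lift ord0 i); rewrite tnthS.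
move=> [ha hx] i; have [<-//|/unlift_some[j -> _]] := eqVneq ord0 i.
by rewrite tnthS; exact: hx.
Qed.

Lemma punctured_ball_cube n : punctured_ball n `<=` cube n.
Proof.
move=> x /= /andP[_ h] i; apply: le_trans h.
rewrite -sqrtr_sqr ler_wsqrtr// (bigD1 i)//= lerDl sumr_ge0// => j _.
exact: sqr_ge0.
Qed.

Section sphere_measure_instance.
Variable n : nat.

Let cone (A : set (tup n)) := punctured_ball n `&` @normalize n @^-1` A.

Let mcone A : measurable A -> measurable (cone A).
Proof.
move=> mA; apply: measurableI; first exact: measurable_punctured_ball.
by rewrite -[X in measurable X]setTI; exact: measurable_normalize.
Qed.

Let sphere_measure0 : sphere_measure n set0 = 0%E.
Proof.
by rewrite /sphere_measure preimage_set0 setI0 measure0 mule0.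
Qed.

Let sphere_measure_ge0 A : (0 <= sphere_measure n A)%E.
Proof. by rewrite /sphere_measure mule_ge0// lee_fin. Qed.

Let sphere_measure_sigma_additive : semi_sigma_additive (sphere_measure n).
Proof.
pose mu := mscale (NngNum (ler0n R n))
  (measure_function_pushforward__canonical__measure_function_Measure
    (measure_function_mrestr__canonical__measure_function_Measure
      (lebesgue_tuple n) (@measurable_punctured_ball n))
    (@measurable_normalize n)).
rewrite (_ : sphere_measure n = mu); first exact: measure_semi_sigma_additive.
apply/funext => A; rewrite /mu/= /mscale/= /pushforward/= /mrestr.
by rewrite /sphere_measure setIC.
Qed.

HB.instance Definition _ := isMeasure.Build _ _ _ (sphere_measure n)
  sphere_measure0 sphere_measure_ge0 sphere_measure_sigma_additive.

Let sphere_measure_fin : fin_num_fun (sphere_measure n).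
Proof.
move=> A mA; rewrite ge0_fin_numE// lte_mul_pinfty// ?lee_fin//.
apply: le_lt_trans (lebesgue_tuple_cube n); apply: le_measure.
- by rewrite inE; exact: mcone.
- by rewrite inE; exact: measurable_cube.
- by move=> x [/punctured_ball_cube].
Qed.

HB.instance Definition _ := Measure_isFinite.Build _ _ _ (sphere_measure n)
  sphere_measure_fin.

End sphere_measure_instance.

End euclidean_measure.
Arguments lebesgue_tuple {R} n.
Arguments sphere_measure {R} n.

Section hyperbolic_space.
Context {R : realType} (N : nat).
Local Notation tup := (N.-tuple (measurableTypeR R)).

Definition sinh (r : R) : R := (expR r - expR (- r)) / 2.
Definition cosh (r : R) : R := (expR r + expR (- r)) / 2.
Definition coth (r : R) : R := cosh r / sinh r.

(* Hyperbolic space is represented in geodesic normal coordinates at the pole: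
   the exponential map at o is a diffeomorphism from R^N onto H^N sending 0 to o,
   and the point with polar coordinates (r, w) is the vector r w.  A function on
   H^N is thus a function on R^N, smooth on H^N minus o iff smooth on R^N minus
   0. *)
Definition partial (i : 'I_N) (u : 'rV[R]_N -> R) : 'rV[R]_N -> R :=
  fun x => 'D_(delta_mx 0 i) u x.

Definition smooth_on (U : set 'rV[R]_N) (u : 'rV[R]_N -> R) : Prop :=
  forall (s : seq 'I_N) (x : 'rV[R]_N), U x ->
    differentiable (foldr partial u s) x.

(* An element of C_c^oo(H^N \ {o}) is identified with its extension by 0 to the
   pole; the last condition keeps the support away from the pole. *)
Definition test_function (u : 'rV[R]_N -> R) : Prop :=
  [/\ smooth_on [set x | x != 0] u,
      compact (closure [set x | u x != 0]) &
      ~ closure [set x | u x != 0] 0].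

Definition polar (u : 'rV[R]_N -> R) (r : R) (w : tup) : R :=
  u (\row_(i < N) (r * tnth w i)).

Definition radial_laplacian (f : R -> tup -> R) (r : R) (w : tup) : R :=
  derive1n 2 (f ^~ w) r + (N%:R - 1) * coth r * derive1 (f ^~ w) r.

(* The integral over H^N with respect to dv = (sinh r)^(N-1) dr dw. *)
Definition hyp_integral (f : R -> tup -> R) : R :=
  \int[(lebesgue_measure \x sphere_measure N)%E]_(p in [set p | 0 < p.1])
    (f p.1 p.2 * sinh p.1 ^+ N.-1).

End hyperbolic_space.

Section constants.
Context {R : realType} (N : nat).
Let d : R := N%:R.

(* $C_{n,0}^n$ *)
Definition C_last (n : nat) : R :=
  let p := n./2 in
  if odd n then
    1 / 2 ^+ (4 * p + 2) *
    \prod_(1 <= j < p.+1)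
      ((d + 4 * j%:R - 2) ^+ 2 * (d - 4 * j%:R - 2) ^+ 2)
  else
    ((d - 4) / 2 ^+ (2 * p)) ^+ 2 *
    \prod_(1 <= j < p)
      ((d + 4 * j%:R) ^+ 2 * (d - 4 * j%:R - 4) ^+ 2).

(* $C_{n,0}^1$ *)
Definition C_first (n : nat) : R :=
  let p := n./2 in
  if odd n then
    d * (d - 1) / 2 ^+ (4 * p + 2) *
      \sum_(1 <= j < p.+1) (d - 1) ^+ (2 * p + 2 * j - 2) +
    (d - 1) ^+ (2 * p) / 2 ^+ (4 * p + 2)
  else
    d * (d - 1) / 2 ^+ (4 * p) *
      \sum_(1 <= j < p.+1) (d - 1) ^+ (4 * p - 2 * j - 2).

(* $\Xi_{\alpha,\beta}^0$ *)
Definition Xi_zero (alpha : R) (beta : nat) : R :=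
  \prod_(0 <= j < beta)
    ((d + alpha + 4 * j%:R) ^+ 2 * (d - alpha - 4 * j%:R - 4) ^+ 2 / 16).

(* $\Xi_{\alpha,\beta}^{2\beta}$, which does not depend on $\alpha$ *)
Definition Xi_last (alpha : R) (beta : nat) : R :=
  ((d - 1) / 4) ^+ (2 * beta).

End constants.

(* Main.v *)
Require Import Defs.
From mathcomp Require Import all_boot all_order all_algebra.
From mathcomp Require Import all_classical all_reals all_analysis.
From mathcomp Require Import measurable_realfun ring lra zify.
Import Order.TTheory GRing.Theory Num.Theory.
Import numFieldNormedType.Exports.

Local Open Scope classical_set_scope.
Set Implicit Arguments.
Unset Strict Implicit.
Unset Printing Implicit Defensive.

Local Open Scope ring_scope.

(** Along a ray the radial Laplacian is the ordinary differential operator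
   [L f = f'' + (N - 1) coth r f'], so the inequality is one-dimensional, with
   weight [sinh^(N-1) r], and the sphere is only integrated over at the end.
   Write [E_n(f)] for the hyperbolic integral of [f^2 / r^n], which is [energy]
   below.  Three inequalities compare [L f] with [f]:

   - [E_0(L f) >= nu^4 E_0(f) + a E_2(f) + b E_4(f)] with [nu = (N - 1) / 2],
     [a > N (N - 1) / 16] and [b > (N - 4)^2 / 16]
     ([improved_poincare_rellich]);
   - [E_n(L f) >= ((N + n)^2 (N - n - 4)^2 / 16) E_(n+4)(f)]
     ([weighted_rellich]);
   - [E_2(L f) >= ((N - 1) / 4)^2 E_2(f)] ([weighted_poincare]).

   Each one is a pointwise inequality between quadratic forms in [f, f', f''],
   up to a divergence [Psi' + (N - 1) coth r Psi] where [Psi] is itself a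
   quadratic form in [f, f']; the integral of a divergence is zero by the
   fundamental theorem of calculus on each ray.  The pointwise inequalities are
   sums of squares once one knows [coth r >= 1], [coth r >= 1 / r] and, for
   [r <= 1], [sinh^4 r <= 12 r^4].

   Applying the first inequality to [L^j u] for [h <= j < m] and telescoping
   bounds the left-hand side of the theorem from below by a combination of the
   [E_2(L^j u)] and of [E_4(L^(m-1) u)].  The third inequality brings every
   [E_2(L^j u)] down to [E_2(u)], the second one brings [E_4(L^(m-1) u)] down to
   [E_(2k)(u)], and the accumulated factors are exactly the two prescribed
   constants ([C_firstE], [C_lastE]), except that [a] and [b] have [1 / 64] to
   spare.  This surplus pays for the intermediate weights, because
   [r^(-2i) <= r^(-2) + r^(-2k)].

   So that every integral makes sense and is additive, all functions are taken
   in the class [ray_smooth], generated by the partial derivatives of [u] in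
   polar coordinates, the coordinates of the direction, [1 / r], [coth r] and
   [sinh r].  This class is stable under radial derivatives, and its members are
   measurable and bounded on annuli. *)

(** * Hyperbolic functions *)

Lemma is_derive_pow {R : realType} (f : R -> R) (n : nat) (r df : R) :
  is_derive r 1 f df ->
  is_derive r 1 (fun t => f t ^+ n) (n%:R * f r ^+ n.-1 * df).
Proof.
move=> fr; have := is_deriveX n fr; rewrite exprfctE => h.
by apply: is_derive_eq.
Qed.

Lemma is_derive_inv_pow {R : realType} (n : nat) (c r : R) : 0 < r ->
  is_derive r 1 (fun t => c * t^-1 ^+ n) (- (c * n%:R * r^-1 ^+ n.+1)).
Proof.
move=> r0; have rn0 : r != 0 by rewrite gt_eqF.
have dV := is_deriveV (f := id) rn0 (is_derive_id r 1).
have d := is_deriveM (is_derive_cst c r 1) (is_derive_pow n dV).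
apply: (is_derive_eq d); rewrite /GRing.scale/= -exprVn.
by case: n {d} => [|n]; rewrite ?mulr0n /= ?exprS; ring.
Qed.

Section hyperbolic_functions.
Context {R : realType}.
Implicit Types r : R.

Lemma is_derive_expRN r :
  is_derive r 1 (fun t : R => expR (- t)) (- expR (- r)).
Proof.
have := @is_derive1_comp R expR (@GRing.opp R) r (expR (- r)) (-1) _ _.
by rewrite mulrN1; apply.
Qed.

Lemma is_derive_sinh r : is_derive r 1 (@sinh R) (cosh r).
Proof.
have dN := is_derive_expRN r.
rewrite (_ : sinh = (2^-1 : R) *: (expR - (fun t : R => expR (- t))));
  last first.
  by apply/funext => t; rewrite /sinh fctE mulrC.
apply: is_derive_eq; rewrite /cosh opprK.
by rewrite mulrC.
Qed.

Lemma is_derive_cosh r : is_derive r 1 (@cosh R) (sinh r).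
Proof.
have dN := is_derive_expRN r.
rewrite (_ : cosh = (2^-1 : R) *: (expR + (fun t : R => expR (- t))));
  last first.
  by apply/funext => t; rewrite /cosh fctE mulrC.
apply: is_derive_eq; rewrite /sinh.
by rewrite mulrC.
Qed.

Lemma cosh2_sinh2 r : cosh r ^+ 2 - sinh r ^+ 2 = 1.
Proof.
have e : expR r * expR (- r) = 1 by rewrite expRN divff ?gt_eqF ?expR_gt0.
rewrite /cosh /sinh.
transitivity (expR r * expR (- r)); last by [].
by field.
Qed.

Lemma cosh_gt0 r : 0 < cosh r.
Proof. by rewrite /cosh divr_gt0// addr_gt0// expR_gt0. Qed.

Lemma sinh_gt0 r : 0 < r -> 0 < sinh r.
Proof.
by move=> r0; rewrite /sinh divr_gt0// subr_gt0 ltr_expR; lra.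
Qed.

Lemma sinh_ge0 r : 0 <= r -> 0 <= sinh r.
Proof.
by move=> r0; rewrite /sinh divr_ge0// subr_ge0 ler_expR; lra.
Qed.

Lemma le_sinh r s : r <= s -> sinh r <= sinh s.
Proof.
move=> rs; rewrite /sinh ler_pM2r// lerB// ler_expR//; lra.
Qed.

Lemma le_cosh r s : 0 <= r -> r <= s -> cosh r <= cosh s.
Proof.
move=> r0 rs; have s1 := sinh_ge0 r0.
rewrite -ler_sqr ?nnegrE ?(ltW (cosh_gt0 _))//.
have h : sinh r ^+ 2 <= sinh s ^+ 2.
  by rewrite lerXn2r ?nnegrE ?le_sinh// (le_trans s1)// le_sinh.
have er := cosh2_sinh2 r; have es := cosh2_sinh2 s.
move: er es h.
by move: (cosh r ^+ 2) (cosh s ^+ 2) (sinh r ^+ 2) (sinh s ^+ 2) => *; lra.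
Qed.

(** The function [r cosh r - sinh r] vanishes at [0] and has derivative
   [r sinh r]. *)
Lemma sinh_le r : 0 < r -> sinh r <= r * cosh r.
Proof.
move=> r0; rewrite -subr_ge0.
pose f t : R := t * cosh t - sinh t.
have df (t : R) : is_derive t 1 f (t * sinh t).
  have dc := is_derive_cosh t; have ds := is_derive_sinh t.
  rewrite (_ : f = id * (@cosh R) - (@sinh R)) //.
  by apply: is_derive_eq; rewrite /GRing.scale/=; ring.
have [|c] := @MVT R f (fun t => t * sinh t) _ _ r0 (fun t _ => df t).
  by apply: derivable_within_continuous => t _.
rewrite in_itv/= => /andP[c0 cr].
rewrite /f mul0r [sinh 0]/sinh oppr0 subrr mul0r subrr oppr0 !addr0 => ->.
exact: mulr_ge0 (mulr_ge0 (ltW c0) (sinh_ge0 (ltW c0))) (ltW r0).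
Qed.

Lemma coth_ge_inv r : 0 < r -> r^-1 <= coth r.
Proof.
move=> r0; rewrite /coth ler_pdivlMr ?sinh_gt0// mulrC ler_pdivrMr// mulrC.
exact: sinh_le.
Qed.

Lemma coth_ge1 r : 0 < r -> 1 <= coth r.
Proof.
move=> r0; rewrite /coth ler_pdivlMr ?sinh_gt0// mul1r /cosh /sinh.
have := expR_gt0 (- r); lra.
Qed.

Lemma coth2B1 r : 0 < r -> coth r ^+ 2 - 1 = (sinh r)^-1 ^+ 2.
Proof.
move=> r0; have s0 : sinh r != 0 by rewrite gt_eqF ?sinh_gt0.
rewrite /coth expr_div_n -[cosh r ^+ 2](subrK (sinh r ^+ 2)) cosh2_sinh2.
by field.
Qed.

Lemma is_derive_coth r : 0 < r -> is_derive r 1 (@coth R) (1 - coth r ^+ 2).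
Proof.
move=> r0; have s0 : sinh r != 0 by rewrite gt_eqF ?sinh_gt0.
have dc := is_derive_cosh r; have ds := is_derive_sinh r.
have dV := is_deriveV s0 ds.
suff : is_derive r 1 ((@cosh R) * (fun t => (sinh t)^-1)) (1 - coth r ^+ 2)
  by [].
apply: is_derive_eq; rewrite /GRing.scale/= /coth.
by field.
Qed.

(** From [exp (1/4) <= 4/3] one gets [cosh 1 <= 11/6], and [(11/6)^4 < 12]. *)
Lemma sinh_le4 r : 0 < r -> r <= 1 -> sinh r ^+ 4 <= 12 * r ^+ 4.
Proof.
move=> r0 r1; have h := sinh_le r0; have c1 := le_cosh (ltW r0) r1.
have e2 : 2 <= expR (1 : R) by have := expR_ge1Dx (1 : R); lra.
have eN x : expR x * expR (- x) = 1 :> R.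
  by rewrite expRN divff ?gt_eqF ?expR_gt0.
have e1 : expR (1 : R) <= 256 / 81.
  rewrite (_ : 1 = 4 * (1 / 4))//; last by lra.
  rewrite expRM_natl.
  have q : expR (1 / 4 : R) <= 4 / 3.
    have := expR_ge1Dx (- (1 / 4) : R); have := eN (1 / 4).
    have := expR_gt0 (1 / 4 : R).
    move: (expR _) (expR _) => a b; nra.
  apply: (@le_trans _ _ ((4 / 3) ^+ 4)); last by lra.
  by rewrite lerXn2r ?nnegrE ?expR_ge0//; lra.
have c2 : cosh (1 : R) <= 11 / 6.
  rewrite /cosh; have := eN 1; move: e1 e2 (expR_gt0 (-1 : R)).
  by move: (expR 1) (expR (-1)) => a b; nra.
have s0 := sinh_ge0 (ltW r0).
have h' : sinh r <= 11 / 6 * r.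
  by apply: (le_trans h); rewrite mulrC ler_pM2r//; lra.
have h2 : sinh r ^+ 4 <= (11 / 6 * r) ^+ 4 by rewrite lerXn2r ?nnegrE//; lra.
apply: (le_trans h2); rewrite exprMn ler_pM2r ?exprn_gt0//; lra.
Qed.

End hyperbolic_functions.

(** * Regularity and support of a test function *)

Section measurable_row.
Context {R : realType} {d : measure_display} {T : measurableType d} {n : nat}.

(** Open sets of [R^n] are countable unions of boxes with rational centre and
   radius, whose preimages are measurable by assumption on the coordinates. *)
Lemma measurable_continuous_row (g : 'rV[R]_n -> R) (phi : T -> 'rV[R]_n) :
  continuous g -> (forall i, measurable_fun setT (fun t => phi t 0 i)) ->
  measurable_fun setT (g \o phi).
Proof.
move=> cg mphi mT; apply: (measurability _ (RGenOInfty.measurableE R)) => //.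
move=> /= _ [_ [a ->] <-]; rewrite setTI.
set U := g @^-1` `]a, +oo[%classic.
have oU : open U by apply: open_comp => // x _; exact: cg.
pose B (c : 'rV[rat]_n * rat) : set 'rV[R]_n :=
  [set y | forall i, `|ratr (c.1 0 i) - y 0 i| < ratr c.2].
rewrite (_ : _ @^-1` _ = \bigcup_(c in [set: 'rV[rat]_n * rat])
    (if pselect (B c `<=` U) then phi @^-1` B c else set0)); last first.
  apply/seteqP; split=> [t /= Ut|t [c _]]; last first.
    by case: pselect => // cU; exact: cU.
  have [e e0 eU] : exists2 e : R, 0 < e & ball (phi t) e `<=` U.
    by have /nbhs_ballP := open_nbhs_nbhs (conj oU Ut : open_nbhs _ _).
  have [q] : exists q : rat, (ratr q : R) \in `]0, (e / 2)[.
    by apply: rat_in_itvoo; rewrite divr_gt0.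
  rewrite in_itv/= => /andP[q0 qe].
  have /choice[c hc] i : exists c : rat,
      (ratr c : R) \in `](phi t 0 i - ratr q), (phi t 0 i + ratr q)[.
    by apply: rat_in_itvoo; lra.
  exists (\row_i c i, q) => //; case: pselect => /= [_ i|[]].
    by rewrite mxE; have := hc i; rewrite in_itv/= ltr_norml; lra.
  move=> y /= yB; apply: eU; split => // i j; rewrite (ord1 i).
  have := yB j; have := hc j; rewrite mxE in_itv/= /ball/= !ltr_norml.
  by move=> /andP[? ?] /andP[? ?]; apply/andP; split; lra.
apply: countable_bigcupT_measurable; first exact: countableP.
move=> c; case: (pselect (B c `<=` U)) => [_|_] /=; last exact: measurable0.
rewrite (_ : _ @^-1` _ = \bigcap_(i in [set: 'I_n])
   ((fun t => phi t 0 i) @^-1`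
     `](ratr (c.1 0 i) - ratr c.2), (ratr (c.1 0 i) + ratr c.2)[%classic)).
  apply: fin_bigcap_measurable => // i _.
  by rewrite -[X in measurable X]setTI; exact: mphi.
apply/seteqP; split=> t /= h i; first move=> _ /=.
  have := h i; rewrite in_itv/= ltr_norml => /andP[? ?].
  by apply/andP; split; lra.
have := h i I; rewrite /= in_itv/= ltr_norml => /andP[? ?].
by apply/andP; split; lra.
Qed.

End measurable_row.

Section euclidean_norm.
Context {R : realType} {n : nat}.
Implicit Types w : n.-tuple (measurableTypeR R).

Lemma enorm_eq1 w : enorm w = 1 -> \sum_(i < n) tnth w i ^+ 2 = 1.
Proof.
move=> w1; have <- : enorm w ^+ 2 = 1 by rewrite w1 expr1n.
by rewrite sqr_sqrtr// sumr_ge0// => i _; exact: sqr_ge0.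
Qed.

Lemma enorm_eq1_coord w i : enorm w = 1 -> `|tnth w i| <= 1.
Proof.
move=> /enorm_eq1 w1; rewrite -(@expr_le1 _ 2)// real_normK ?num_real// -w1.
by rewrite (bigD1 i)//= lerDl sumr_ge0// => j _; exact: sqr_ge0.
Qed.

End euclidean_norm.

Section test_functions.
Context {R : realType} {N : nat}.
Local Notation tup := (N.-tuple (measurableTypeR R)).
Variable u : 'rV[R]_N -> R.
Hypothesis hu : test_function u.

Let K := closure [set x | u x != 0].

Lemma partials_eq0 s x : ~ K x -> foldr (@partial R N) u s x = 0.
Proof.
elim: s x => [|i s IH] x nKx /=.
  by apply/eqP/negP => /negP ux; apply: nKx; exact: subset_closure.
rewrite /partial (@near_eq_derive _ _ _ _ (cst 0)) ?derive_cst//.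
have : nbhs x (~` K).
  by apply: open_nbhs_nbhs; split => //; exact/closed_openC/closed_closure.
by apply: filterS => y nKy; exact: IH.
Qed.

Lemma near_partials_eq0 s x : ~ K x -> \near x, foldr (@partial R N) u s x = 0.
Proof.
move=> nKx; have : nbhs x (~` K).
  by apply: open_nbhs_nbhs; split => //; exact/closed_openC/closed_closure.
by apply: filterS => y nKy; exact: partials_eq0.
Qed.

Lemma differentiable_partials s x : K x ->
  differentiable (foldr (@partial R N) u s) x.
Proof.
case: hu => smooth _ nK0 Kx; apply: smooth => /=.
by apply/eqP => x0; apply: nK0; rewrite -x0.
Qed.

Lemma continuous_partials s : continuous (foldr (@partial R N) u s).
Proof.
move=> x; have [Kx|nKx] := pselect (K x).
  exact/differentiable_continuous/differentiable_partials.
apply/(@cvgrPdist_lt R R _ (nbhs x) (nbhs_filter x)) => e e0.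
rewrite partials_eq0//.
by apply: filterS (near_partials_eq0 s nKx) => y ->; rewrite subrr normr0.
Qed.

Lemma is_derive_partials s (x v : 'rV[R]_N) :
  is_derive x v (foldr (@partial R N) u s)
    (\sum_(i < N) v 0 i * foldr (@partial R N) u (i :: s) x).
Proof.
have [Kx|nKx] := pselect (K x).
  have df := differentiable_partials s Kx.
  apply: DeriveDef; first exact: diff_derivable.
  rewrite deriveE// [in LHS](row_sum_delta v) linear_sum/=.
  by apply: eq_bigr => i _; rewrite linearZ/= /partial deriveE.
under eq_bigr do rewrite partials_eq0// mulr0.
rewrite big1_eq; apply: (@near_eq_is_derive _ _ _ (cst 0)).
  by apply: filterS (near_partials_eq0 s nKx) => y /= ->.
Qed.

Lemma polarE (g : 'rV[R]_N -> R) r (w : tup) :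
  polar g r w = g (r *: \row_i tnth w i).
Proof. by congr g; apply/rowP => i; rewrite !mxE. Qed.

(** The radial derivative is the directional derivative along [w]. *)
Lemma is_derive_polar s (r : R) (w : tup) :
  is_derive r 1 (polar (foldr (@partial R N) u s) ^~ w)
    (\sum_(i < N) tnth w i * polar (foldr (@partial R N) u (i :: s)) r w).
Proof.
set g := foldr (@partial R N) u s; set v : 'rV[R]_N := \row_i tnth w i.
have [dg eg] := is_derive_partials s (r *: v) v.
have e (h : R) : h^-1 *: ((g \o shift (r *: v)) (h *: v) - g (r *: v)) =
    h^-1 *: (((polar g ^~ w) \o shift r) (h *: (1 : R)) - polar g r w).
  by rewrite /= !polarE -/v scalerDl [h *: (1 : R)]mulr1.
have {}e := funext e.
apply: DeriveDef; first by rewrite /derivable -e.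
rewrite {1}/derive -e -[LHS]/('D_v g (r *: v)) eg.
by apply: eq_bigr => i _; rewrite mxE polarE.
Qed.

Lemma measurable_polar s :
  measurable_fun setT
    (fun p : R * tup => polar (foldr (@partial R N) u s) p.1 p.2).
Proof.
apply: (@measurable_continuous_row _ _ (R * tup)%type N
  (foldr (@partial R N) u s)
  (fun p => \row_(i < N) (p.1 * tnth p.2 i))); first exact: continuous_partials.
move=> i; under eq_fun do rewrite mxE.
apply: measurable_funM => //.
exact: (measurableT_comp (measurable_tnth i)).
Qed.

Lemma bounded_polar s :
  exists M, forall r (w : tup), `|polar (foldr (@partial R N) u s) r w| <= M.
Proof.
case: hu => _ cK _; set g := foldr (@partial R N) u s.
have cg : {within K, continuous (fun x => `|g x|)}.
  apply: continuous_subspaceT => x.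
  apply: continuous_comp; first exact: continuous_partials.
  exact: norm_continuous.
have [x0|x0] := pselect (K !=set0); last first.
  exists 0 => r w; rewrite polarE [g _]partials_eq0 ?normr0// => Kx.
  by apply: x0; eexists; exact: Kx.
have [c _ hc] := EVT_max_rV x0 cK cg.
exists `|g c| => r w; rewrite polarE.
set x := (X in g X); have [Kx|nKx] := pselect (K x).
  by apply: hc; rewrite inE.
by rewrite [g x]partials_eq0// normr0.
Qed.

(** Compactness bounds the support from above, and the pole being off the
   support bounds it from below. *)
Lemma support_annulus : exists e M : R, [/\ 0 < e, 0 < M &
  forall x, K x -> (forall i, `|x 0 i| <= M) /\ ~ (forall i, `|x 0 i| < e)].
Proof.
case: hu => _ cK nK0.
have [M [_ hM]] := compact_bounded cK.
have [e e0 eK] : exists2 e : R, 0 < e & ball (0 : 'rV[R]_N) e `<=` ~` K.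
  apply/nbhs_ballP; apply: open_nbhs_nbhs; split => //.
  exact/closed_openC/closed_closure.
have M10 : 0 < Num.max M 0 + 1 by rewrite ltr_wpDl// le_max lexx orbT.
have MM1 : M < Num.max M 0 + 1 by rewrite ltr_pwDr// le_max lexx.
move: (Num.max M 0 + 1) M10 MM1 => M1 M10 /hM {}hM.
exists e, M1; split => [||x Kx]; [exact: e0|exact: M10|split].
  move=> i; apply: le_trans (hM _ Kx).
  by rewrite [X in _ <= X]mx_normrE; exact: (le_bigmax _ _ (0, i)).
move=> h; apply: (eK x _ Kx); split => [|i j]; first exact: e0.
by rewrite /ball/= mxE sub0r normrN (ord1 i); exact: h.
Qed.

Lemma polar_support : exists A B : R, [/\ 0 < A, A < B &
  forall s r (w : tup), enorm w = 1 -> 0 < r -> r < A \/ B < r ->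
    polar (foldr (@partial R N) u s) r w = 0].
Proof.
have [e [M [e0 M0 hK]]] := support_annulus.
exists e, (e + 1 + N%:R * M); split => //.
  by rewrite -addrA ltrDl ltr_wpDr// mulr_ge0// ltW.
move=> s r w w1 r0 rAB; rewrite polarE; apply: partials_eq0 => /hK[hM he].
have xE i : (r *: \row_j tnth w j : 'rV[R]_N) 0 i = r * tnth w i.
  by rewrite !mxE.
have w2 := enorm_eq1 w1; have wi i := enorm_eq1_coord i w1.
case: rAB => [rA|Br].
  apply: he => i; rewrite xE normrM gtr0_norm//.
  by apply: le_lt_trans rA; rewrite ler_piMr// ltW.
suff : r <= N%:R * M by move=> rM; move: (lt_le_trans Br rM) e0; lra.
(* the sum of the squared coordinates of [w] is at most that of their absolute
   values *)
have -> : r = \sum_(i < N) r * tnth w i ^+ 2 by rewrite -mulr_sumr w2 mulr1.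
rewrite (@le_trans _ _ (\sum_(i < N) M))//.
  apply: ler_sum => i _; apply: le_trans (hM i); rewrite xE normrM gtr0_norm//.
  by rewrite ler_pM2l// -real_normK ?num_real// expr2 ler_piMr.
by rewrite sumr_const card_ord mulr_natl.
Qed.

End test_functions.

(** * Smooth functions of the polar coordinates *)

Section ray_smooth.
Context {R : realType} {N : nat}.
Local Notation tup := (N.-tuple (measurableTypeR R)).
Variable u : 'rV[R]_N -> R.
Hypothesis hu : test_function u.

(** An inductive class, so that closure under radial derivatives, measurability
   and boundedness are all proved by induction.  Only radii [r > 0] matter:
   [coth] and the inverse have no derivative at [0], hence the last
   constructor. *)
Inductive ray_smooth : (R -> tup -> R) -> Prop :=
| ray_smooth_polar s : ray_smooth (polar (foldr (@partial R N) u s))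
| ray_smooth_cst c : ray_smooth (fun _ _ => c)
| ray_smooth_coord i : ray_smooth (fun _ w => tnth w i)
| ray_smooth_inv : ray_smooth (fun r _ => r^-1)
| ray_smooth_coth : ray_smooth (fun r _ => coth r)
| ray_smooth_sinh : ray_smooth (fun r _ => sinh r)
| ray_smoothD F G : ray_smooth F -> ray_smooth G ->
    ray_smooth (fun r w => F r w + G r w)
| ray_smoothM F G : ray_smooth F -> ray_smooth G ->
    ray_smooth (fun r w => F r w * G r w)
| ray_smooth_ext F G : ray_smooth F ->
    (forall r w, 0 < r -> F r w = G r w) -> ray_smooth G.

Lemma ray_smoothN F : ray_smooth F -> ray_smooth (fun r w => - F r w).
Proof.
move=> sF; apply: ray_smooth_ext (ray_smoothM (ray_smooth_cst (-1)) sF) _.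
by move=> r w _; rewrite mulN1r.
Qed.

Lemma ray_smoothB F G : ray_smooth F -> ray_smooth G ->
  ray_smooth (fun r w => F r w - G r w).
Proof. by move=> sF sG; apply: ray_smoothD => //; exact: ray_smoothN. Qed.

Lemma ray_smoothX F n : ray_smooth F -> ray_smooth (fun r w => F r w ^+ n).
Proof.
move=> sF; elim: n => [|n IH]; first exact: (ray_smooth_cst 1).
by apply: ray_smooth_ext (ray_smoothM sF IH) _ => r w _; rewrite exprS.
Qed.

Lemma ray_smooth_sum (I : Type) (s : seq I) (F : I -> R -> tup -> R) :
  (forall i, ray_smooth (F i)) -> ray_smooth (fun r w => \sum_(i <- s) F i r w).
Proof.
move=> sF; elim: s => [|i s IH].
  by apply: ray_smooth_ext (ray_smooth_cst 0) _ => r w _; rewrite big_nil.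
by apply: ray_smooth_ext (ray_smoothD (sF i) IH) _ => r w _; rewrite big_cons.
Qed.

Lemma ray_smooth_is_derive F : ray_smooth F -> exists2 G, ray_smooth G &
  forall (r : R) w, 0 < r -> is_derive r 1 (F ^~ w) (G r w).
Proof.
elim=> {F}.
- move=> s; exists (fun r w => \sum_(i < N) tnth w i *
    polar (foldr (@partial R N) u (i :: s)) r w).
    apply: ray_smooth_sum => i; apply: ray_smoothM (ray_smooth_coord i) _.
    exact: ray_smooth_polar.
  by move=> r w _; exact: is_derive_polar.
- move=> c; exists (fun _ _ => 0); first exact: (ray_smooth_cst 0).
  by move=> r w _; exact: is_derive_cst.
- move=> c; exists (fun _ _ => 0); first exact: (ray_smooth_cst 0).
  by move=> r w _; exact: is_derive_cst.
- exists (fun r w => - (r^-1 ^+ 2)).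
    by apply: ray_smoothN; apply: ray_smoothX; exact: ray_smooth_inv.
  move=> r w r0; have rn0 : r != 0 by rewrite gt_eqF.
  have := is_deriveV (f := id) rn0 (is_derive_id r 1).
  by move=> h; apply: is_derive_eq; rewrite exprVn /GRing.scale/= mulr1.
- exists (fun r w => 1 - coth r ^+ 2); last first.
    by move=> r w; exact: is_derive_coth.
  apply: ray_smoothB; first exact: ray_smooth_cst.
  by apply: ray_smoothX; exact: ray_smooth_coth.
- exists (fun r w => coth r * sinh r).
    by apply: ray_smoothM; [exact: ray_smooth_coth|exact: ray_smooth_sinh].
  move=> r w r0; rewrite /coth divfK ?gt_eqF ?sinh_gt0//; exact: is_derive_sinh.
- move=> F G _ [F' sF' dF] _ [G' sG' dG].
  exists (fun r w => F' r w + G' r w); first exact: ray_smoothD.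
  by move=> r w r0; exact: (is_deriveD (dF r w r0) (dG r w r0)).
- move=> F G sF [F' sF' dF] sG [G' sG' dG].
  exists (fun r w => F r w * G' r w + G r w * F' r w).
    by apply: ray_smoothD; exact: ray_smoothM.
  by move=> r w r0; exact: (is_deriveM (dF r w r0) (dG r w r0)).
- move=> F G sF [F' sF' dF] FG; exists F' => // r w r0.
  apply: (@near_eq_is_derive _ _ _ (F ^~ w)); last exact: dF.
  by near=> t; rewrite FG//; near: t; exact: lt_nbhsr.
Unshelve. all: by end_near. Qed.

Definition radial_derive (F : R -> tup -> R) (r : R) (w : tup) : R :=
  derive1 (F ^~ w) r.

Lemma is_derive_radial F (r : R) w : ray_smooth F -> 0 < r ->
  is_derive r 1 (F ^~ w) (radial_derive F r w).
Proof.
move=> /ray_smooth_is_derive[G _ dF] r0; rewrite /radial_derive derive1E.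
by have [d _] := dF r w r0; apply: DeriveDef.
Qed.

Lemma ray_smooth_derive F : ray_smooth F -> ray_smooth (radial_derive F).
Proof.
move=> sF; have [G sG dF] := ray_smooth_is_derive sF.
apply: ray_smooth_ext sG _ => r w r0.
by rewrite /radial_derive derive1E; have [_ ->] := dF r w r0.
Qed.

Lemma radial_laplacianE (F : R -> tup -> R) :
  radial_laplacian F = fun r w => radial_derive (radial_derive F) r w +
    (N%:R - 1) * coth r * radial_derive F r w.
Proof. by []. Qed.

Lemma measurable_of_radius (f : R -> R) :
  (forall r : R, 0 < r -> derivable f r 1) ->
  measurable_fun [set p : R * tup | 0 < p.1] (fun p => f p.1).
Proof.
move=> df.
have mf : measurable_fun (`]0, +oo[%classic : set R) f.
  apply: open_continuous_measurable_fun => //.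
  move=> r; rewrite inE/= in_itv/= andbT => r0.
  by apply/differentiable_continuous/derivable1_diffP; exact: df.
apply: (measurable_comp _ _ mf) => //.
  by move=> _ [p /= p0 <-]; rewrite in_itv/= p0.
by apply: measurable_funTS; exact: measurable_fst.
Qed.

Lemma measurable_ray_smooth F : ray_smooth F ->
  measurable_fun [set p : R * tup | 0 < p.1] (fun p => F p.1 p.2).
Proof.
elim=> {F}.
- by move=> s; apply: measurable_funTS; exact: measurable_polar.
- by move=> c; exact: measurable_cst.
- move=> i; apply: measurable_funTS.
  exact: (measurableT_comp (measurable_tnth i)).
- apply: (@measurable_of_radius (fun r => r^-1)) => r r0.
  by apply: derivableV => //; rewrite gt_eqF.
- by apply: measurable_of_radius => r r0; have [] := is_derive_coth r0.
- by apply: measurable_of_radius => r r0; have [] := is_derive_sinh r.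
- by move=> F G _ mF _ mG; exact: measurable_funD.
- by move=> F G _ mF _ mG; exact: measurable_funM.
- move=> F G _ mF FG; apply: eq_measurable_fun mF => p; rewrite inE/= => p0.
  by rewrite FG.
Qed.

(** The bound is uniform in the direction, which gives integrability. *)
Lemma bounded_ray_smooth F (a b : R) : ray_smooth F -> 0 < a ->
  exists M, forall r (w : tup), enorm w = 1 -> a <= r <= b -> `|F r w| <= M.
Proof.
move=> sF a0; elim: sF => {F}.
- move=> s; have [M hM] := bounded_polar hu s.
  by exists M => r w _ _; exact: hM.
- by move=> c; exists `|c|.
- by move=> i; exists 1 => r w w1 _; exact: enorm_eq1_coord.
- exists a^-1 => r w _ /andP[ar _].
  by rewrite ger0_norm ?invr_ge0 ?lef_pV2 ?posrE//; lra.
- exists (cosh b / sinh a) => r w _ /andP[ar rb].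
  have r0 : 0 < r by lra.
  have c0 := cosh_gt0 r; have s0 := sinh_gt0 r0; have s1 := sinh_gt0 a0.
  rewrite /coth ger0_norm; last by rewrite divr_ge0// ltW.
  rewrite ler_pM ?(ltW c0) ?invr_ge0 ?(ltW s0) ?le_cosh ?(ltW r0)//.
  by rewrite lef_pV2 ?posrE// le_sinh.
- exists (sinh b) => r w _ /andP[ar rb].
  by rewrite ger0_norm ?le_sinh// sinh_ge0//; lra.
- move=> F G _ [M hM] _ [M' hM']; exists (M + M') => r w w1 rab.
  by apply: le_trans (ler_normD _ _) _; rewrite lerD ?hM ?hM'.
- move=> F G _ [M hM] _ [M' hM']; exists (M * M') => r w w1 rab.
  by rewrite normrM ler_pM ?hM ?hM'.
- move=> F G _ [M hM] FG; exists M => r w w1 /[dup] rab /andP[ar _].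
  by rewrite -FG ?hM//; lra.
Qed.

End ray_smooth.

(** * Integration over annuli *)

Section radial_integral.
Context {R : realType} {N : nat}.
Local Notation tup := (N.-tuple (measurableTypeR R)).
Local Notation mu := (lebesgue_measure \x @sphere_measure R N)%E.
Variable u : 'rV[R]_N -> R.
Hypothesis hu : test_function u.

Let S : set tup := [set w | enorm w = 1].
Let D : set (measurableTypeR R * tup) := [set p | 0 < p.1].
Let E (a b : R) : set (measurableTypeR R * tup) := `[a, b]%classic `*` S.

Let mS : measurable S.
Proof.
rewrite (_ : S = @enorm R N @^-1` [set 1]) //.
by rewrite -[X in measurable X]setTI; apply: measurable_enorm.
Qed.

Let mD : measurable D.
Proof.
rewrite (_ : D = fst @^-1` (`]0, +oo[%classic : set R)).
  by rewrite -[X in measurable X]setTI; apply: measurable_fst.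
by apply/seteqP; split => p /=; rewrite in_itv/= andbT.
Qed.

Let mE a b : measurable (E a b).
Proof. exact: measurableX. Qed.

Let ED a b : 0 < a -> E a b `<=` D.
Proof.
move=> a0 p [/=]; rewrite in_itv/= => /andP[ap _] _.
by rewrite /D/=; lra.
Qed.

Let muX (A : set (measurableTypeR R)) (B : set tup) :
  measurable A -> measurable B ->
  mu (A `*` B) = (lebesgue_measure A * sphere_measure N B)%E.
Proof. exact: product_measure1E. Qed.

(** Normalized vectors have norm [1], so the sphere measure lives on [S]. *)
Lemma sphere_measure_compl : sphere_measure N (~` S) = 0%E.
Proof.
rewrite /sphere_measure (_ : _ `&` _ = set0) ?measure0 ?mule0//.
apply/seteqP; split => // w [/andP[w0 _]]; apply; rewrite /S/=.
rewrite [in LHS]/enorm; under eq_bigr do rewrite tnth_mktuple expr_div_n.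
rewrite -mulr_suml -[X in X / _]sqr_sqrtr; last first.
  by rewrite sumr_ge0// => i _; exact: sqr_ge0.
by rewrite divff ?sqrtr1// expf_neq0// gt_eqF.
Qed.

(** A vanishing condition on the unit sphere alone is enough, since the other
   directions form a null set. *)
Lemma hyp_integral_annulus F (a b : R) : ray_smooth u F -> 0 < a ->
  (forall r (w : tup), enorm w = 1 -> 0 < r -> r < a \/ b < r -> F r w = 0) ->
  hyp_integral F = \int[mu]_(p in E a b) (F p.1 p.2 * sinh p.1 ^+ N.-1).
Proof.
move=> sF a0 F0; rewrite /hyp_integral /Rintegral; congr fine.
have sG := ray_smoothM sF (ray_smoothX N.-1 (ray_smooth_sinh u)).
have /measurable_EFinP mG := measurable_ray_smooth hu sG.
rewrite -[in RHS](setIidr (@ED a b a0)) integral_mkcondr.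
apply: ae_eq_integral => //.
  apply/(measurable_restrict _ (mE a b) mD).
  by apply: measurable_funS mG => //; exact: subIsetl.
exists ([set: R] `*` ~` S); split.
- by apply: measurableX => //; exact: measurableC.
- apply: etrans (muX measurableT (measurableC mS)) _.
  by rewrite sphere_measure_compl mule0.
- move=> [r w] /= /not_implyP[r0 h]; split => // w1; apply: h.
  rewrite patchE; case: ifPn => //; rewrite notin_setE => h.
  rewrite F0 ?mul0r//.
  have [ra|ar] := ltP r a; [by left|right].
  rewrite ltNge; apply/negP => rb; apply: h; split => //=.
  by rewrite in_itv/= ar rb.
Qed.

Lemma integrable_annulus G (a b : R) : ray_smooth u G -> 0 < a ->
  mu.-integrable (E a b) (fun p => (G p.1 p.2)%:E).
Proof.
move=> sG a0; have [M hM] := bounded_ray_smooth hu b sG a0.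
apply: (@measurable_bounded_integrable _ _ _ mu (fun p => G p.1 p.2)).
- exact: mE.
- have fE : (lebesgue_measure `[a, b]%classic * sphere_measure N S < +oo)%E.
    rewrite lte_mul_pinfty//.
    + by rewrite /= lebesgue_measure_itv/=; case: ifP.
    + by rewrite ltey_eq fin_num_measure.
  by apply: le_lt_trans fE; rewrite -muX.
- apply: measurable_funS (measurable_ray_smooth hu sG) => //; exact: ED.
- exists M; split => [|x Mx [r w] [/= rab w1]]; first exact: num_real.
  by apply: le_trans (ltW Mx); exact: hM.
Qed.

(** Integrating along the rays first, by Fubini's theorem, reduces this to the
   fundamental theorem of calculus on each ray. *)
Lemma integral_radial_derive G (a b : R) : ray_smooth u G -> 0 < a -> a < b ->
  (forall w, enorm w = 1 -> G a w = 0 /\ G b w = 0) ->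
  \int[mu]_(p in E a b) radial_derive G p.1 p.2 = 0.
Proof.
move=> sG a0 ab Gab; have sG' := ray_smooth_derive hu sG.
have iG' := integrable_annulus b sG' a0.
rewrite /Rintegral integral_mkcond -integral21_prod_meas1; last first.
  by exact: (iffLR (integrable_mkcond _ (mE a b)) iG').
rewrite (eq_integral (cst 0%E)); first by rewrite integral0.
move=> w _; rewrite /fubini_G.
have [w1|w1] := pselect (S w); last first.
  under eq_integral.
    move=> r _; rewrite patchE ifF; last by apply/negP; rewrite inE => -[].
    over.
  by rewrite integral0.
transitivity (\int[lebesgue_measure]_(r in `[a, b]) (radial_derive G r w)%:E)%E.
  rewrite [RHS]integral_mkcond; apply: eq_integral => r _.
  rewrite !patchE; congr (if _ then _ else _).
  by apply/idP/idP; rewrite !inE/=; [case|move=> ?; split].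
rewrite (continuous_FTC2 (F := G ^~ w))//.
- by have [-> ->] := Gab w w1; rewrite subee.
- apply: continuous_in_subspaceT => r; rewrite inE/= in_itv/= => /andP[ar _].
    have r0 : 0 < r by lra.
    have [d _] := is_derive_radial hu w sG' r0.
    exact/differentiable_continuous/derivable1_diffP.
- have c r : 0 < r -> {for r, continuous (G ^~ w)}.
      move=> r0; have [d _] := is_derive_radial hu w sG r0.
      exact/differentiable_continuous/derivable1_diffP.
    split.
  + move=> r; rewrite in_itv/= => /andP[ar _].
      by have r0 : 0 < r by [lra]; have [] := is_derive_radial hu w sG r0.
  + by apply: cvg_at_right_filter; exact: c.
  + by apply: cvg_at_left_filter; apply: c; lra.
Qed.

End radial_integral.

(** * Functions supported in an annulus and the divergence theorem *)

Section annular_functions.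
Context {R : realType} {N : nat}.
Local Notation tup := (N.-tuple (measurableTypeR R)).
Variables (u : 'rV[R]_N -> R) (A B : R).
Hypotheses (hu : test_function u) (N0 : (0 < N)%N) (A0 : 0 < A) (AB : A < B).

(** The support is only controlled in unit directions, which carry the sphere
   measure; [A] and [B] are fixed because they are inherited from [u] by all the
   functions derived from it. *)
Definition annular (F : R -> tup -> R) : Prop := ray_smooth u F /\
  forall r w, enorm w = 1 -> 0 < r -> r < A \/ B < r -> F r w = 0.

Lemma annularD F G : annular F -> annular G ->
  annular (fun r w => F r w + G r w).
Proof.
move=> [sF F0] [sG G0]; split => [|r w w1 r0 h]; first exact: ray_smoothD.
by rewrite F0// G0// addr0.
Qed.

Lemma annularM F G : annular F -> ray_smooth u G ->
  annular (fun r w => F r w * G r w).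
Proof.
move=> [sF F0] sG; split => [|r w w1 r0 h]; first exact: ray_smoothM.
by rewrite F0// mul0r.
Qed.

Lemma annular_ext F G : annular F -> (forall r w, 0 < r -> F r w = G r w) ->
  annular G.
Proof.
move=> [sF F0] FG; split => [|r w w1 r0 h]; first exact: ray_smooth_ext FG.
by rewrite -FG// F0.
Qed.

Lemma annularZ c F : annular F -> annular (fun r w => c * F r w).
Proof.
move=> aF; apply: annular_ext (annularM aF (ray_smooth_cst u c)) _ => r w _.
by rewrite mulrC.
Qed.

(** The two radial ranges where [F] vanishes are open, so that [F] vanishes near
   each of their points. *)
Lemma annular_derive F : annular F -> annular (radial_derive F).
Proof.
move=> [sF F0]; split => [|r w w1 r0 h]; first exact: ray_smooth_derive.
rewrite /radial_derive derive1E (@near_eq_derive _ _ _ _ (cst 0)) ?derive_cst//.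
case: h => h; near=> t.
  by rewrite F0//; [near: t; exact: lt_nbhsr|left; near: t; exact: lt_nbhsl].
by rewrite F0//; [near: t; exact: lt_nbhsr|right; near: t; exact: lt_nbhsr].
Unshelve. all: by end_near. Qed.

Lemma annular_laplacian F : annular F -> annular (radial_laplacian F).
Proof.
move=> aF; rewrite radial_laplacianE; have aF' := annular_derive aF.
apply: annularD; first exact: annular_derive.
apply: annular_ext (annularM aF' (ray_smoothM (ray_smooth_cst u (N%:R - 1))
  (ray_smooth_coth u))) _ => r w _.
by rewrite mulrC.
Qed.

Let E : set (measurableTypeR R * tup) :=
  `[A, B]%classic `*` [set w | enorm w = 1].
Local Notation mu := (lebesgue_measure \x @sphere_measure R N)%E.

Let integralE F : annular F ->
  hyp_integral F = \int[mu]_(p in E) (F p.1 p.2 * sinh p.1 ^+ N.-1).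
Proof.
move=> [sF F0]; have h := hyp_integral_annulus hu sF A0 F0. exact: h.
Qed.

Let integrableF F : annular F ->
  mu.-integrable E (fun p => (F p.1 p.2 * sinh p.1 ^+ N.-1)%:E).
Proof.
move=> [sF _].
have sG := ray_smoothM sF (ray_smoothX N.-1 (ray_smooth_sinh u)).
by have h := integrable_annulus hu B sG A0; exact: h.
Qed.

Let mE : measurable E.
Proof.
apply: measurableX => //.
rewrite (_ : mkset _ = @enorm R N @^-1` [set 1]) //.
by rewrite -[X in measurable X]setTI; apply: measurable_enorm.
Qed.

Lemma hyp_integralD F G : annular F -> annular G ->
  hyp_integral (fun r w => F r w + G r w) = hyp_integral F + hyp_integral G.
Proof.
move=> aF aG; rewrite !integralE//; last exact: annularD.
under eq_Rintegral do rewrite mulrDl.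
rewrite RintegralD//; [exact: integrableF aF|exact: integrableF aG].
Qed.

Lemma hyp_integralZ c F : annular F ->
  hyp_integral (fun r w => c * F r w) = c * hyp_integral F.
Proof.
move=> aF; rewrite !integralE//; last exact: annularZ.
under eq_Rintegral do rewrite -mulrA.
by rewrite RintegralZl//; exact: integrableF aF.
Qed.

Lemma eq_hyp_integral (F G : R -> tup -> R) :
  (forall r w, 0 < r -> F r w = G r w) -> hyp_integral F = hyp_integral G.
Proof.
by move=> FG; apply: eq_Rintegral => p; rewrite inE/= => p0; rewrite FG.
Qed.

Lemma hyp_integral_ge0 (F : R -> tup -> R) :
  (forall r w, 0 < r -> 0 <= F r w) -> 0 <= hyp_integral F.
Proof.
move=> F0; apply: Rintegral_ge0 => p /= p0.
by rewrite mulr_ge0 ?F0// exprn_ge0// sinh_ge0// ltW.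
Qed.

(** The divergence theorem: [F' + (N - 1) coth r F] is the divergence of the
   radial vector field with component [F]. *)
Lemma hyp_integral_divergence F : annular F ->
  hyp_integral
    (fun r w => radial_derive F r w + (N%:R - 1) * coth r * F r w) = 0.
Proof.
move=> aF; have [sF F0] := aF; have aF' := annular_derive aF.
set G := fun r w => _.
have [sG G0] : annular G.
  apply: annularD => //.
  apply: annular_ext (annularM aF (ray_smoothM (ray_smooth_cst u (N%:R - 1))
    (ray_smooth_coth u))) _ => r w _; by rewrite mulrC.
(* on the larger annulus [A / 2 <= r <= B + 1], [F] vanishes at both ends *)
have a0 : 0 < A / 2 by rewrite divr_gt0.
have B0 : 0 < B := lt_trans A0 AB.
have BA : 0 < B - A by rewrite subr_gt0.
rewrite (hyp_integral_annulus hu (a := A / 2) (b := B + 1) sG a0); last first.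
  by move=> r w w1 r0 h; apply: G0 => //; case: h => h; [left|right]; lra.
have sH := ray_smoothM sF (ray_smoothX N.-1 (ray_smooth_sinh u)).
have := @integral_radial_derive R N u hu (fun r w => F r w * sinh r ^+ N.-1)
  (A / 2) (B + 1) sH a0.
move=> <-; last first.
- move=> w w1; split; first by rewrite F0 ?mul0r//; left; lra.
  by rewrite F0 ?mul0r//; [lra|right; lra].
- by rewrite -subr_gt0; lra.
apply: eq_Rintegral => -[r w]; rewrite inE/= => -[/=].
rewrite in_itv/= => /andP[ar _] _.
have r0 : 0 < r by lra.
have s0 : sinh r != 0 by rewrite gt_eqF ?sinh_gt0.
rewrite [RHS]/radial_derive derive1E.
have dF := is_derive_radial hu w sF r0.
have dX := is_derive_pow N.-1 (is_derive_sinh r).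
have dFX : is_derive r 1 (fun t : R => F t w * sinh t ^+ N.-1) _ :=
  is_deriveM dF dX.
have [_ ->] := dFX.
have N1 : N%:R - 1 = N.-1%:R :> R by rewrite -[in LHS](prednK N0) -natr1 addrK.
rewrite /G N1 /GRing.scale/= /coth.
case: N.-1 => [|n] /=; first by rewrite !mul0r expr0; ring.
by rewrite exprS; field.
Qed.

(** This turns pointwise inequalities modulo divergences into integral ones. *)
Lemma hyp_integral_ge_divergence P F : annular P -> annular F ->
  (forall r w, 0 < r ->
    radial_derive F r w + (N%:R - 1) * coth r * F r w <= P r w) ->
  0 <= hyp_integral P.
Proof.
move=> aP aF h; have d0 := hyp_integral_divergence aF.
set G := fun r w => _ in d0.
have aG : annular G.
  apply: annularD; first exact: annular_derive.
  apply: annular_ext (annularM aF (ray_smoothM (ray_smooth_cst u (N%:R - 1))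
    (ray_smooth_coth u))) _ => r w _; by rewrite mulrC.
have -> : hyp_integral P = hyp_integral (fun r w => P r w + (-1) * G r w).
  by rewrite hyp_integralD ?hyp_integralZ ?d0 ?mulr0 ?addr0//; exact: annularZ.
by apply: hyp_integral_ge0 => r w r0; rewrite mulN1r subr_ge0 h.
Qed.

End annular_functions.

(** * Energy inequalities for the radial Laplacian *)

(* Squares come before products, because [x ^+ 2] unifies with [x * x]. *)
Ltac nonneg := repeat first [assumption | exact: sqr_ge0
  | apply: exprn_ge0; assumption | apply: mulr_ge0 | apply: addr_ge0].

(** The right-hand side is the potential left over by the squares in
   [improved_poincare_rellich], where [s] is [1 / sinh^2 r].  For [r >= 1] the
   surplus [(d - 1) (d - 2) / 16] in the coefficient of [r^(-2)] absorbs the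
   term in [r^(-4)]; for [r <= 1] the bound [s^2 >= r^(-4) / 12] does. *)
Lemma inv_radius_le_coth {R : realType} (d r nu c s : R) : 5 <= d -> 0 < r ->
  nu = (d - 1) / 2 -> c = nu * (nu - 1) -> s = coth r ^+ 2 - 1 ->
  (d * (d - 1) / 16 + 1 / 64) * r^-1 ^+ 2 +
    ((d - 4) ^+ 2 / 16 + 1 / 64) * r^-1 ^+ 4 <=
  nu ^+ 2 / 2 * r^-1 ^+ 2 + (2 * nu ^+ 2 - 5 / 2) * c * s +
    (c ^+ 2 - 3 / 2 * c) * s ^+ 2.
Proof.
move=> d5 r0 nuE cE sE.
have p0 : 0 < r^-1 by rewrite invr_gt0.
have c2 : 2 <= c by rewrite cE nuE; nra.
have nu2 : 2 <= nu by rewrite nuE; lra.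
have s0 : 0 <= s by rewrite sE coth2B1// sqr_ge0.
have h1 : 0 <= (2 * nu ^+ 2 - 5 / 2) * c * s.
  rewrite !mulr_ge0//; last by lra.
  by nra.
have h2 : 0 <= c ^+ 2 - 3 / 2 * c by nra.
have [r1|r1] := leP r 1; last first.
  have p1 : r^-1 <= 1 by rewrite invf_le1// ltW.
  have h3 : 0 <= (c ^+ 2 - 3 / 2 * c) * s ^+ 2 by rewrite mulr_ge0// sqr_ge0.
  have p4 : r^-1 ^+ 4 <= r^-1 ^+ 2 by rewrite ler_wiXn2l// ltW.
  have p2 := sqr_ge0 r^-1.
  have h4 : ((d - 4) ^+ 2 / 16 + 1 / 64) * r^-1 ^+ 4 <=
      ((d - 4) ^+ 2 / 16 + 1 / 64) * r^-1 ^+ 2.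
    by rewrite ler_wpM2l// addr_ge0// divr_ge0// sqr_ge0.
  have h5 : 0 <= (nu ^+ 2 / 2 - (d * (d - 1) / 16 + 1 / 64) -
      ((d - 4) ^+ 2 / 16 + 1 / 64)) * r^-1 ^+ 2.
    by rewrite mulr_ge0// nuE; nra.
  move: h1 h3 h4 h5.
  move: (_ * s) (_ * s ^+ 2) (r^-1 ^+ 4) (r^-1 ^+ 2) => x y p q; lra.
have h3 : r^-1 ^+ 4 <= 12 * s ^+ 2.
  have sr : 0 < sinh r := sinh_gt0 r0.
  rewrite sE coth2B1// -exprM !exprVn ler_pdivlMr ?exprn_gt0//.
  rewrite mulrC ler_pdivrMr ?exprn_gt0//; exact: sinh_le4.
(* a polynomial in [t = d - 4 >= 1] that is positive already at [t = 1] *)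
have h4 : 0 <= (c ^+ 2 - 3 / 2 * c) / 12 - ((d - 4) ^+ 2 / 16 + 1 / 64).
  rewrite cE nuE; set t := d - 4; have t1 : 1 <= t by rewrite /t; lra.
  have -> : ((d - 1) / 2 * ((d - 1) / 2 - 1)) = (t ^+ 2 + 4 * t + 3) / 4.
    by rewrite /t; field.
  have -> : (((t ^+ 2 + 4 * t + 3) / 4) ^+ 2 -
     3 / 2 * ((t ^+ 2 + 4 * t + 3) / 4)) / 12 - (t ^+ 2 / 16 + 1 / 64) =
     (t ^+ 4 + 8 * t ^+ 3 + 4 * t ^+ 2 - 12) / 192.
    by field.
  rewrite divr_ge0//.
  have t2 : 1 <= t ^+ 2 by rewrite exprn_ege1.
  have t3 : 1 <= t ^+ 3 by rewrite exprn_ege1.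
  have t4 : 1 <= t ^+ 4 by rewrite exprn_ege1.
  lra.
have h5 : 0 <= (nu ^+ 2 / 2 - (d * (d - 1) / 16 + 1 / 64)) * r^-1 ^+ 2.
  by rewrite mulr_ge0 ?sqr_ge0// nuE; nra.
have h6 := ler_wpM2l h2 h3.
have h7 := mulr_ge0 h4 (exprn_ge0 4 (ltW p0)).
move: h1 h5 h6 h7; move: (c ^+ 2 - _) => e.
move: (_ * s) (s ^+ 2) (r^-1 ^+ 4) (r^-1 ^+ 2) => x y p q.
lra.
Qed.

Section energies.
Context {R : realType} {N : nat}.
Local Notation tup := (N.-tuple (measurableTypeR R)).
Variables (u : 'rV[R]_N -> R) (A B : R).
Hypotheses (hu : test_function u) (N0 : (0 < N)%N) (A0 : 0 < A) (AB : A < B).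
Local Notation annular := (annular u A B).

Definition energy (n : nat) (F : R -> tup -> R) : R :=
  hyp_integral (fun r w => F r w ^+ 2 / r ^+ n).

Lemma energy_ge0 n F : 0 <= energy n F.
Proof.
apply: hyp_integral_ge0 => r w r0.
by rewrite divr_ge0 ?sqr_ge0// exprn_ge0// ltW.
Qed.

Lemma annular_energy n F : annular F ->
  annular (fun r w => F r w ^+ 2 / r ^+ n).
Proof.
move=> aF; have [sF _] := aF.
apply: annular_ext (annularM (annularM aF sF)
  (ray_smoothX n (ray_smooth_inv u))) _ => r w r0.
by rewrite exprVn expr2.
Qed.

Lemma energy_lower_bound F G Psi n (cs : seq (R * nat)) :
  annular F -> annular G -> annular Psi ->
  (forall r w, 0 < r ->
    radial_derive Psi r w + (N%:R - 1) * coth r * Psi r w +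
    \sum_(c <- cs) c.1 * (F r w ^+ 2 / r ^+ c.2) <= G r w ^+ 2 / r ^+ n) ->
  \sum_(c <- cs) c.1 * energy c.2 F <= energy n G.
Proof.
move=> aF aG aPsi h.
have a0 : annular (fun r w => 0).
  by apply: annular_ext (annularZ 0 aF) _ => r w _; rewrite mul0r.
have [aS sumE] :
    annular (fun r w => \sum_(c <- cs) c.1 * (F r w ^+ 2 / r ^+ c.2)) /\
    hyp_integral (fun r w => \sum_(c <- cs) c.1 * (F r w ^+ 2 / r ^+ c.2)) =
    \sum_(c <- cs) c.1 * energy c.2 F.
  elim: cs {h} => [|c cs [aS IH]].
    split; first by apply: annular_ext a0 _ => r w _; rewrite big_nil.
    rewrite big_nil.
    transitivity (hyp_integral (fun (r : R) (w : tup) => 0 * F r w)).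
      by apply: eq_hyp_integral => r w _; rewrite big_nil mul0r.
    by rewrite (hyp_integralZ hu A0 _ aF) mul0r.
  have aE := annular_energy c.2 aF; have aZ := annularZ c.1 aE.
  split.
    by apply: annular_ext (annularD aZ aS) _ => r w _; rewrite big_cons.
  rewrite big_cons -IH -(hyp_integralZ hu A0 _ aE) -(hyp_integralD hu A0 aZ aS).
  by apply: eq_hyp_integral => r w _; rewrite big_cons.
have aE := annular_energy n aG; have aZ := annularZ (-1) aS.
rewrite -sumE -subr_ge0 -[X in _ - X]mul1r -mulNr -(hyp_integralZ hu A0 _ aS).
rewrite /energy -(hyp_integralD hu A0 aE aZ).
apply: (hyp_integral_ge_divergence hu N0 A0 AB (annularD aE aZ) aPsi) => r w r0.
by rewrite mulN1r lerBrDr; exact: h.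
Qed.

(** Each weight [r^(-2i)] is at most [r^(-2k)] when [r <= 1] and at most
   [r^(-2)] when [r >= 1]. *)
Lemma energy_interpolation F (i k : nat) : annular F -> (1 <= i <= k)%N ->
  energy (2 * i) F <= energy 2 F + energy (2 * k) F.
Proof.
move=> aF /andP[i1 ik].
have aE n := annular_energy n aF.
have aN := annularZ (-1) (aE (2 * i)%N).
have aP := annularD (aE 2%N) (aE (2 * k)%N).
rewrite /energy -(hyp_integralD hu A0 (aE 2%N) (aE (2 * k)%N)) -subr_ge0.
rewrite -mulN1r -(hyp_integralZ hu A0 _ (aE _)) -(hyp_integralD hu A0 aP aN).
apply: hyp_integral_ge0 => r w r0.
rewrite mulN1r subr_ge0 -mulrDr ler_wpM2l ?sqr_ge0//.
have h0 n : 0 <= (r ^+ n)^-1 by rewrite invr_ge0 exprn_ge0// ltW.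
have [r1|r1] := leP r 1.
  rewrite (@le_trans _ _ (r ^+ (2 * k))^-1)// ?lerDr//.
  rewrite lef_pV2 ?posrE ?exprn_gt0//.
  by apply: ler_wiXn2l => //; [exact: ltW|lia].
rewrite (@le_trans _ _ (r ^+ 2)^-1)// ?lerDl//.
rewrite lef_pV2 ?posrE ?exprn_gt0//.
by apply: ler_weXn2l => //; [exact: ltW|lia].
Qed.

(** The divergences used below come from quadratic forms in a function and its
   radial derivative, with radial coefficients. *)
Definition radial_form (q0 q1 q2 : R -> R) (F : R -> tup -> R)
    (r : R) (w : tup) : R :=
  q0 r * F r w ^+ 2 + q1 r * (F r w * radial_derive F r w) +
  q2 r * radial_derive F r w ^+ 2.

Lemma annular_radial_form (q0 q1 q2 : R -> R) F :
  ray_smooth u (fun r (_ : tup) => q0 r) ->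
  ray_smooth u (fun r (_ : tup) => q1 r) ->
  ray_smooth u (fun r (_ : tup) => q2 r) ->
  annular F -> annular (radial_form q0 q1 q2 F).
Proof.
move=> s0 s1 s2 aF; have aF' := annular_derive hu aF.
have [[sF _] [sF' _]] := (aF, aF').
apply: annular_ext (annularD (annularD
  (annularM (annularM aF sF) s0)
  (annularM (annularM aF sF') s1)) (annularM (annularM aF' sF') s2)) _ => r w _.
by rewrite /radial_form; ring.
Qed.

Lemma radial_derive_form (q0 q1 q2 : R -> R) (dq0 dq1 dq2 : R) F (r : R) w :
  annular F -> 0 < r ->
  is_derive r 1 q0 dq0 -> is_derive r 1 q1 dq1 -> is_derive r 1 q2 dq2 ->
  let f := F r w in let f1 := radial_derive F r w in
  let f2 := radial_derive (radial_derive F) r w in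
  radial_derive (radial_form q0 q1 q2 F) r w =
  dq0 * f ^+ 2 + q0 r * (2 * f * f1) + dq1 * (f * f1) +
  q1 r * (f1 ^+ 2 + f * f2) + dq2 * f1 ^+ 2 + q2 r * (2 * f1 * f2).
Proof.
move=> [sF _] r0 d0 d1 d2 f f1 f2.
have dF := is_derive_radial hu w sF r0.
have dF' := is_derive_radial hu w (ray_smooth_derive hu sF) r0.
have d : is_derive r 1 (radial_form q0 q1 q2 F ^~ w) _ :=
  is_deriveD (is_deriveD (is_deriveM d0 (is_derive_pow 2 dF))
    (is_deriveM d1 (is_deriveM dF dF'))) (is_deriveM d2 (is_derive_pow 2 dF')).
rewrite [LHS]/radial_derive derive1E; have [_ ->] := d.
rewrite /GRing.scale/= mulrfctE -/f -/f1 -/f2 !expr1; ring.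
Qed.


Lemma ray_smooth_inv_pow (n : nat) (c : R) :
  ray_smooth u (fun r (_ : tup) => c * r^-1 ^+ n).
Proof.
apply: (ray_smoothM (ray_smooth_cst u c)).
exact: ray_smoothX n (ray_smooth_inv u).
Qed.

(** Two Hardy-type squares.  With [m = (N + n) / 2], expanding
   [(L f - m f' / r)^2 / r^n] bounds [E_n(L f)] by [m^2 E_(n+2)(f')]; with
   [k = (N - n - 4) / 2], expanding [(f' + k f / r)^2 / r^(n+2)] then bounds
   [E_(n+2)(f')] by [k^2 E_(n+4)(f)].  Both use [coth r >= 1 / r]. *)
Lemma weighted_rellich n F : annular F -> (n + 4 <= N)%N ->
  (N%:R + n%:R) ^+ 2 * (N%:R - n%:R - 4) ^+ 2 / 16 * energy (n + 4)%N F <=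
  energy n (radial_laplacian F).
Proof.
move=> aF nN; set a : R := n%:R.
have aN : a + 4 <= N%:R by rewrite /a -(natrD _ n 4) ler_nat.
have a0 : 0 <= a by exact: ler0n.
pose m := (N%:R + a) / 2; pose k := (N%:R - a - 4) / 2.
pose Psi := radial_form (fun r => - (m ^+ 2 * k) * r^-1 ^+ (n + 3)%N)
  (fun r => 0) (fun r => m * r^-1 ^+ n.+1) F.
have := @energy_lower_bound F (radial_laplacian F) Psi n
  [:: (m ^+ 2 * k ^+ 2, (n + 4)%N)].
rewrite big_seq1
  (_ : m ^+ 2 * k ^+ 2 = (N%:R + a) ^+ 2 * (N%:R - a - 4) ^+ 2 / 16);
  last by rewrite /m /k; field.
apply => //; first exact: annular_laplacian.
  apply: annular_radial_form aF; [exact: ray_smooth_inv_pow|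
    exact: ray_smooth_cst|exact: ray_smooth_inv_pow].
move=> r w r0; rewrite big_seq1.
rewrite (radial_derive_form w aF r0
  (is_derive_inv_pow (n + 3)%N (- (m ^+ 2 * k)) r0)
  (is_derive_cst 0 r 1) (is_derive_inv_pow n.+1 m r0)).
rewrite radial_laplacianE /Psi /radial_form -!exprVn !natrD -natr1 -/a.
rewrite !exprS !exprD.
have pC := coth_ge_inv r0; have p0 : 0 < r^-1 by rewrite invr_gt0.
move: (exprn_ge0 n (ltW p0)); move: (r^-1 ^+ n) => P P0.
move: (coth r) (r^-1) pC p0 (F r w) (radial_derive F r w)
  (radial_derive (radial_derive F) r w) => C p pC p0 f f1 f2 /=.
rewrite -subr_ge0; set X := (X in 0 <= X).
have -> : X = P * ((f2 + (N%:R - 1) * C * f1 - m * f1 * p) ^+ 2 +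
   m * (N%:R - 1) * (C - p) * p * f1 ^+ 2 +
   m ^+ 2 * p ^+ 2 * (f1 + k * f * p) ^+ 2 +
   m ^+ 2 * k * (N%:R - 1) * (C - p) * p ^+ 3 * f ^+ 2).
  by rewrite /X /m /k; field.
have N1 : 0 <= N%:R - 1 :> R by lra.
have m0 : 0 <= m by rewrite /m; lra.
have k0 : 0 <= k by rewrite /k; lra.
have Cp : 0 <= C - p by lra.
have p0' := ltW p0.
by nonneg.
Qed.

(** The squares are now [(L f - m f')^2] and [(f' + k f)^2], with the constants
   [m = (N - 1) / 2] and [k = (N - 3) / 2]; [coth r >= 1] and [coth r >= 1 / r]
   give the factor [m^2 k^2], and [k >= 1 / 2]. *)
Lemma weighted_poincare F : annular F -> (4 <= N)%N ->
  ((N%:R - 1) / 4) ^+ 2 * energy 2 F <= energy 2 (radial_laplacian F).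
Proof.
move=> aF nN; have N4 : 4 <= N%:R :> R by rewrite ler_nat.
pose m := (N%:R - 1) / 2 : R; pose k := (N%:R - 3) / 2 : R.
pose Psi := radial_form (fun r => - (m ^+ 2 * k) * r^-1 ^+ 2) (fun r => 0)
  (fun r => m * r^-1 ^+ 2) F.
have := @energy_lower_bound F (radial_laplacian F) Psi 2
  [:: (((N%:R - 1) / 4) ^+ 2, 2%N)].
rewrite big_seq1; apply => //; first exact: annular_laplacian.
  apply: annular_radial_form aF; [exact: ray_smooth_inv_pow|
    exact: ray_smooth_cst|exact: ray_smooth_inv_pow].
move=> r w r0; rewrite big_seq1.
rewrite (radial_derive_form w aF r0 (is_derive_inv_pow 2 (- (m ^+ 2 * k)) r0)
  (is_derive_cst 0 r 1) (is_derive_inv_pow 2 m r0)).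
rewrite radial_laplacianE /Psi /radial_form -!exprVn.
have pC := coth_ge_inv r0; have C1 := coth_ge1 r0.
have p0 : 0 < r^-1 by rewrite invr_gt0.
move: (coth r) (r^-1) pC C1 p0 (F r w) (radial_derive F r w)
  (radial_derive (radial_derive F) r w) => C p pC C1 p0 f f1 f2 /=.
rewrite -subr_ge0; set X := (X in 0 <= X).
have -> : X = p ^+ 2 * ((f2 + (N%:R - 1) * C * f1 - m * f1) ^+ 2 +
   m * ((N%:R - 1) * (C - 1) + 2 * p) * f1 ^+ 2 + m ^+ 2 * (f1 + k * f) ^+ 2 +
   m ^+ 2 * k * ((N%:R - 3) * (C - 1) + 2 * (C - p)) * f ^+ 2 +
   m ^+ 2 * (k ^+ 2 - 1 / 4) * f ^+ 2).
  by rewrite /X /m /k; field.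
have m0 : 0 <= m by rewrite /m; lra.
have k0 : 1 / 2 <= k by rewrite /k; lra.
have k2 : 0 <= k ^+ 2 - 1 / 4 by nra.
have k0' : 0 <= k by lra.
have x1 : 0 <= (N%:R - 1) * (C - 1) + 2 * p by nra.
have x2 : 0 <= (N%:R - 3) * (C - 1) + 2 * (C - p) by nra.
by nonneg.
Qed.

(** Conjugation by [sinh^nu] turns [L] into [D^2 - V], where
   [D f = f' + nu coth r f] and [V = nu^2 + c / sinh^2 r].  Expanding
   [(D^2 f - V f)^2] and integrating by parts leaves
   [(D^2 f)^2 + 2 V (D f)^2 + (V^2 - V'') f^2].  The term [2 nu^2 (D f)^2] is
   bounded below through the square of [D f - f / (2 r)], and
   [2 c (D f)^2 / sinh^2 r] through that of [D f - (3 / 2) coth r f].  The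
   coefficients [q0] and [q1] collect the divergences of these steps. *)
Lemma improved_poincare_rellich F : annular F -> (5 <= N)%N ->
  ((N%:R - 1) / 2) ^+ 4 * energy 0 F +
    (N%:R * (N%:R - 1) / 16 + 1 / 64) * energy 2 F +
    ((N%:R - 4) ^+ 2 / 16 + 1 / 64) * energy 4 F <=
  energy 0 (radial_laplacian F).
Proof.
move=> aF nN; have N5 : 5 <= N%:R :> R by rewrite ler_nat.
pose d : R := N%:R; pose nu : R := (d - 1) / 2; pose c : R := nu * (nu - 1).
pose q0 (r : R) : R := c * (coth r * (coth r ^+ 2 - 1)) + nu ^+ 2 * r^-1 ^+ 1 -
  2 * nu * (coth r * (nu ^+ 2 + c * (coth r ^+ 2 - 1))).
pose q1 (r : R) : R := - 2 * (nu ^+ 2 + c * (coth r ^+ 2 - 1)).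
pose Psi := radial_form q0 q1 (fun r => 0) F.
have := @energy_lower_bound F (radial_laplacian F) Psi 0
  [:: (nu ^+ 4, 0%N); (d * (d - 1) / 16 + 1 / 64, 2%N);
      ((d - 4) ^+ 2 / 16 + 1 / 64, 4%N)].
rewrite !big_cons !big_nil addr0 addrA; apply => //.
  exact: annular_laplacian.
  have sS : ray_smooth u (fun r (_ : tup) => coth r ^+ 2 - 1).
    apply: ray_smoothB (ray_smoothX 2 (ray_smooth_coth u)) (ray_smooth_cst u 1).
  have sV : ray_smooth u (fun r (_ : tup) => nu ^+ 2 + c * (coth r ^+ 2 - 1)).
    apply: ray_smoothD; first exact: ray_smooth_cst.
    exact: ray_smoothM (ray_smooth_cst u c) sS.
  apply: annular_radial_form aF; last exact: ray_smooth_cst.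
    apply: ray_smoothB; first apply: ray_smoothD.
    - apply: ray_smoothM (ray_smooth_cst u c) _.
      exact: ray_smoothM (ray_smooth_coth u) sS.
    - exact: ray_smooth_inv_pow.
    - apply: ray_smoothM (ray_smooth_cst u _) _.
      exact: ray_smoothM (ray_smooth_coth u) sV.
  exact: ray_smoothM (ray_smooth_cst u _) sV.
move=> r w r0; have dC := is_derive_coth r0.
have dS : is_derive r 1 (fun t : R => coth t ^+ 2 - 1) _ :=
  is_deriveB (is_derive_pow 2 dC) (is_derive_cst (1 : R) r 1).
have dV : is_derive r 1 (fun t : R => nu ^+ 2 + c * (coth t ^+ 2 - 1)) _ :=
  is_deriveD (is_derive_cst (nu ^+ 2) r 1)
    (is_deriveM (is_derive_cst c r 1) dS).
have d1 : is_derive r 1 q1 _ := is_deriveM (is_derive_cst (- 2 : R) r 1) dV.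
have d0 : is_derive r 1 q0 _ := is_deriveB (is_deriveD
    (is_deriveM (is_derive_cst c r 1) (is_deriveM dC dS))
    (is_derive_inv_pow 1 (nu ^+ 2) r0))
  (is_deriveM (is_derive_cst (2 * nu : R) r 1) (is_deriveM dC dV)).
rewrite (radial_derive_form w aF r0 d0 d1 (is_derive_cst 0 r 1)).
rewrite radial_laplacianE /Psi /radial_form !big_cons big_nil /= -!exprVn.
have h := inv_radius_le_coth N5 r0 (erefl _) (erefl _) (erefl _).
rewrite /q0 /q1 /GRing.scale/= -/d ?mulrfctE ?addrfctE ?opprfctE /cst/=.
have s0 : 0 <= coth r ^+ 2 - 1 by rewrite coth2B1// sqr_ge0.
have c0 : 0 <= c by rewrite /c /nu /d; nra.
move: h; rewrite -/d -/nu -/c.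
move: (coth r) (r^-1) s0 (F r w) (radial_derive F r w)
  (radial_derive (radial_derive F) r w) => C p s0 f f1 f2 h.
rewrite -subr_ge0; set X := (X in 0 <= X).
pose g := f1 + nu * C * f; pose s := C ^+ 2 - 1.
have -> : X = (f2 + 2 * nu * C * f1 + (nu ^+ 2 + c * s) * f) ^+ 2 +
  2 * nu ^+ 2 * (g - f * p / 2) ^+ 2 + 2 * c * s * (g - 3 / 2 * C * f) ^+ 2 +
  f ^+ 2 * (nu ^+ 2 / 2 * p ^+ 2 + (2 * nu ^+ 2 - 5 / 2) * c * s +
    (c ^+ 2 - 3 / 2 * c) * s ^+ 2 - ((d * (d - 1) / 16 + 1 / 64) * p ^+ 2 +
    ((d - 4) ^+ 2 / 16 + 1 / 64) * p ^+ 4)).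
  by rewrite /X /g /s /c /nu; field.
move: h; rewrite -/s -subr_ge0 => h.
have n0 : 0 <= nu ^+ 2 := sqr_ge0 nu.
have h2 : 0 <= 2 :> R by [].
by nonneg.
Qed.

End energies.

(** * Iterating the energy inequalities *)

Section energy_iteration.
Context {R : realType} (N : nat).
Let d : R := N%:R.

Definition rellich_const (n : nat) : R :=
  (d + n%:R) ^+ 2 * (d - n%:R - 4) ^+ 2 / 16.

Definition rellich_prod (p h : nat) : R :=
  \prod_(0 <= i < p.-1 + h) rellich_const (4 + 4 * i).

Definition poincare_sum (p h : nat) : R :=
  \sum_(0 <= j < p)
    ((d - 1) / 2) ^+ (4 * (p.-1 - j)) * ((d - 1) / 4) ^+ (2 * (h + j)).

Lemma rellich_const_ge0 n : 0 <= rellich_const n.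
Proof. by rewrite divr_ge0// mulr_ge0// sqr_ge0. Qed.

(** [C_last] accounts for the weights [4, 8, ..., 4 (p - 1)], and [Xi_zero] for
   the [h] weights that follow. *)
Lemma C_lastE p h : (0 < p)%N ->
  C_last N (2 * p) * Xi_zero N (2 * (2 * p)%:R) h =
  (d - 4) ^+ 2 / 16 * rellich_prod p h.
Proof.
case: p => // p _; rewrite /C_last /Xi_zero /rellich_prod -/d.
rewrite mul2n odd_double doubleK.
rewrite [in RHS](big_cat_nat (n := p)) ?leq_addr//= mulrA.
congr (_ * _); last first.
  rewrite [RHS](big_addn 0 _ p) addKn.
  apply: eq_big_nat => i _; rewrite /rellich_const.
  have -> : 2 * (p.+1.*2)%:R = 4 + 4 * p%:R :> R.
    by rewrite -mul2n natrM -natr1; ring.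
  have -> : (4 + 4 * (i + p))%:R = 4 + 4 * i%:R + 4 * p%:R :> R.
    by rewrite !(natrD, natrM); ring.
  by congr (_ ^+ 2 * _ ^+ 2 / _); ring.
rewrite big_add1 /=.
rewrite (eq_bigr (fun i => 16 * rellich_const (4 + 4 * i))); last first.
  move=> i _; rewrite /rellich_const -natr1 !(natrD, natrM).
  by field.
rewrite big_split/= prodr_const_nat subn0 mulrA; congr (_ * _).
have -> : (2 : R) ^+ (2 * p.+1) = 4 ^+ p.+1.
  by rewrite exprM; congr (_ ^+ _); lra.
have -> : (16 : R) ^+ p = (4 ^+ p) ^+ 2.
  by rewrite -exprM mulnC exprM; congr (_ ^+ _); lra.
have q0 : (4 : R) ^+ p != 0 by rewrite expf_neq0.
by rewrite [_ ^+ p.+1]exprS; move: (_ ^+ p) q0 => q q0; field.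
Qed.

Lemma C_firstE p h : (0 < p)%N ->
  C_first N (2 * p) * Xi_last N 2 h = d * (d - 1) / 16 * poincare_sum p h.
Proof.
case: p => // p _; rewrite /C_first /Xi_last /poincare_sum -/d.
rewrite mul2n odd_double doubleK.
rewrite big_add1/= -mulrA mulr_suml !mulr_sumr.
apply: eq_big_nat => j /andP[_ jp].
have -> : (4 * p.+1 - 2 * j.+1 - 2 = 4 * (p - j) + 2 * j)%N by lia.
have -> : (4 * p.+1 = 4 + 4 * (p - j) + 2 * (2 * j))%N by lia.
have -> : (2 * (h + j) = 2 * h + 2 * j)%N by lia.
have two0 n : (2 : R) ^+ n != 0 by rewrite expf_neq0.
have four0 n : (4 : R) ^+ n != 0 by rewrite expf_neq0.
move: (4 * (p - j))%N (2 * j)%N (2 * h)%N => x y z.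
have -> : (2 : R) ^+ (4 + x + 2 * y) = 16 * 2 ^+ x * 4 ^+ y.
  rewrite exprD [X in X * _]exprD [X in _ * X]exprM.
  by congr (_ * _ * _ ^+ _); lra.
rewrite !expr_div_n [(d - 1) ^+ (x + y)]exprD.
rewrite [(d - 1) ^+ (z + y)]exprD [4 ^+ (z + y)]exprD.
move: (two0 x) (four0 y) (four0 z).
move: ((2 : R) ^+ x) ((4 : R) ^+ y) ((4 : R) ^+ z).
move: ((d - 1) ^+ x) ((d - 1) ^+ y) ((d - 1) ^+ z).
by move=> DX DY DZ X Y Z X0 Y0 Z0; field; rewrite X0 Y0 Z0.
Qed.

(** From here on, [e j n] stands for the energy with weight [r^(-n)] of the
   [j]-th iterated Laplacian. *)
Variable e : nat -> nat -> R.
Hypothesis e0 : forall j n, 0 <= e j n.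
Variables (a b : R).
Hypotheses (a0 : 0 <= a) (b0 : 0 <= b) (N1 : (1 <= N)%N).
Hypothesis eA : forall j,
  ((d - 1) / 2) ^+ 4 * e j 0 + a * e j 2 + b * e j 4 <= e j.+1 0.
Hypothesis eP : forall j, ((d - 1) / 4) ^+ 2 * e j 2 <= e j.+1 2.
Hypothesis eR : forall j n, (n + 4 <= N)%N ->
  rellich_const n * e j (n + 4)%N <= e j.+1 n.

Let d1 : 0 <= d - 1.
Proof. by rewrite subr_ge0 ler1n. Qed.

Lemma poincare_iter j : ((d - 1) / 4) ^+ (2 * j) * e 0 2 <= e j 2.
Proof.
elim: j => [|j IH]; first by rewrite muln0 expr0 mul1r.
apply: le_trans (eP j); rewrite mulnS exprD -mulrA ler_wpM2l// sqr_ge0//.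
Qed.

Lemma rellich_iter j n : (n + 4 * j <= N)%N ->
  \prod_(0 <= i < j) rellich_const (n + 4 * i) * e 0 (n + 4 * j)%N <= e j n.
Proof.
elim: j n => [|j IH] n nN; first by rewrite big_nil mul1r muln0 addn0.
have nN4 : (n + 4 <= N)%N by lia.
apply: le_trans (eR j nN4); rewrite big_nat_recl//= muln0 addn0 -mulrA.
rewrite ler_wpM2l ?rellich_const_ge0//.
have nE i : (n + 4 * i.+1 = n + 4 + 4 * i)%N by lia.
under eq_bigr do rewrite nE.
by rewrite nE IH// -nE.
Qed.

(** The telescoping is stopped one step short of [e (h + p.+1) 0], so that the
   term in [e (h + p) 4] of the last step is still available in
   [energy_iter]. *)
Lemma spectral_gap_iter h p :
  ((d - 1) / 2) ^+ (4 * p.+1) * e h 0 +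
    a * \sum_(0 <= j < p.+1) ((d - 1) / 2) ^+ (4 * (p - j)) * e (h + j)%N 2 <=
  ((d - 1) / 2) ^+ 4 * e (h + p)%N 0 + a * e (h + p)%N 2.
Proof.
elim: p => [|p IH].
  by rewrite big_nat1 !subnn muln0 expr0 mul1r muln1 addn0.
rewrite big_nat_recr//= subnn muln0 expr0 mul1r [in leLHS]mulrDr addrA lerD2r.
have : ((d - 1) / 2) ^+ 4 * e (h + p)%N 0 + a * e (h + p)%N 2 <=
    e (h + p.+1)%N 0.
  by rewrite addnS; apply: le_trans (eA _); rewrite lerDl mulr_ge0.
move=> /(le_trans IH).
move=> /(ler_wpM2l (exprn_ge0 4 (divr_ge0 d1 (ler0n _ 2)))).
apply: le_trans; rewrite mulrDr mulrA -exprD -mulnS lerD2l mulrCA ler_wpM2l//.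
rewrite mulr_sumr le_eqVlt; apply/orP; left; apply/eqP.
apply: eq_big_nat => j /andP[_ jp]; rewrite mulrA -exprD.
by congr (_ ^+ _ * _); lia.
Qed.

Lemma energy_iter h p : (0 < p)%N -> (4 * (h + p) <= N)%N ->
  a * poincare_sum p h * e 0 2 + b * rellich_prod p h * e 0 (4 * (h + p))%N <=
  e (h + p)%N 0 - ((d - 1) / 2) ^+ (4 * p) * e h 0.
Proof.
case: p => // p _ hp; rewrite lerBrDl addnS; apply: le_trans (eA _).
rewrite addrA; apply: lerD; last first.
  rewrite -mulrA ler_wpM2l//; have := @rellich_iter (h + p) 4.
  have -> : (4 + 4 * (h + p) = 4 * (h + p).+1)%N by lia.
  by rewrite /rellich_prod /= [(p + h)%N]addnC; apply; lia.
apply: le_trans (spectral_gap_iter h p).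
rewrite lerD2l -mulrA ler_wpM2l// mulr_suml.
apply: ler_sum => j _; rewrite -mulrA ler_wpM2l ?poincare_iter//.
by rewrite exprn_ge0// divr_ge0.
Qed.

End energy_iteration.

(** * The main inequality *)

Lemma rellich_prod_gt0 {R : realType} (N p h : nat) :
  (4 * (p + h) < N)%N -> (0 < p)%N -> 0 < rellich_prod N p h :> R.
Proof.
move=> hN p0; rewrite /rellich_prod big_nat; apply: prodr_gt0 => i /andP[_ ip].
have iN : (4 + 4 * i + 4 < N)%N by lia.
have : (4 + 4 * i)%:R + 4 < N%:R :> R by rewrite -(natrD _ _ 4) ltr_nat.
rewrite /rellich_const => h1.
have h2 : 0 <= (4 + 4 * i)%:R :> R by exact: ler0n.
by rewrite divr_gt0// mulr_gt0// exprn_gt0//; lra.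
Qed.

Lemma poincare_sum_gt0 {R : realType} (N p h : nat) :
  (1 < N)%N -> (0 < p)%N -> 0 < poincare_sum N p h :> R.
Proof.
move=> N1; case: p => // p _; rewrite /poincare_sum.
have d1 : 0 < N%:R - 1 :> R by rewrite subr_gt0 ltr1n.
rewrite big_nat_recl//= ltr_wpDr//.
  by apply: sumr_ge0 => j _; rewrite mulr_ge0// exprn_ge0// divr_ge0// ltW.
by rewrite mulr_gt0// exprn_gt0// divr_gt0.
Qed.

Theorem theorem4p2 (R : realType) (N k l m h : nat)
    (hk : k = (2 * m)%N) (hl : l = (2 * h)%N) (hlk : (l < k)%N)
    (hN : (2 * k < N)%N) :
  exists C : nat -> R,
    [/\ forall i : nat, (1 <= i <= k)%N -> 0 < C i,
        C k = C_last N (k - l) * Xi_zero N (2 * (k - l)%:R) l./2,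
        C 1%N = C_first N (k - l) * Xi_last N 2 l./2 &
        forall u : 'rV[R]_N -> R, test_function u ->
          hyp_integral (fun r w =>
            iter m (@radial_laplacian R N) (polar u) r w ^+ 2)
          - ((N%:R - 1) / 2) ^+ (4 * (m - h)) *
            hyp_integral (fun r w =>
              iter h (@radial_laplacian R N) (polar u) r w ^+ 2)
          >= \sum_(1 <= i < k.+1)
               C i * hyp_integral (fun r w => polar u r w ^+ 2 / r ^+ (2 * i))].
Proof.
have [p p0 mE] : exists2 p, (0 < p)%N & m = (h + p)%N by exists (m - h)%N; lia.
have klE : (k - l = 2 * p)%N by lia.
have hE : l./2 = h by rewrite hl mul2n doubleK.
have pE : (m - h = p)%N by lia.
rewrite klE hE pE C_lastE// C_firstE//.
have N5 : (5 <= N)%N by lia.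
have k4 : (2 * k = 4 * (h + p))%N by lia.
have k4N : (4 * (h + p) <= N)%N by lia.
have N0 : (0 < N)%N by apply: leq_trans N5.
have d5 : 5 <= N%:R :> R by rewrite ler_nat.
set S := poincare_sum N p h; set P := rellich_prod N p h.
have S0 : 0 < S by apply: poincare_sum_gt0 => //; lia.
have P0 : 0 < P by apply: rellich_prod_gt0 => //; lia.
set a := N%:R * (N%:R - 1) / 16; set b := (N%:R - 4) ^+ 2 / 16.
have a0 : 0 < a by rewrite /a divr_gt0// mulr_gt0//; lra.
have b0 : 0 < b by rewrite /b divr_gt0// exprn_gt0//; lra.
have [k' kE] : exists k', k = k'.+2 by exists k.-2; lia.
(* the surplus [1 / 64] in [a] and [b], shared by the [k - 2] other constants *)
pose e := Num.min S P / (64 * k%:R).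
have kR : 0 < k%:R :> R by rewrite ltr0n kE.
have e0 : 0 < e by rewrite divr_gt0 ?mulr_gt0// lt_min S0 P0.
have ek : e * k'%:R <= Num.min S P / 64.
  have -> : Num.min S P / 64 = e * k%:R by rewrite /e; field; rewrite gt_eqF.
  by rewrite ler_pM2l// ler_nat kE; lia.
move: e e0 ek => e e0 ek.
exists (fun i => if i == 1%N then a * S else if i == k then b * P else e).
split.
- move=> i _; case: ifP => _; first exact: mulr_gt0.
  by case: ifP => _ //; exact: mulr_gt0.
- by rewrite eqxx kE.
- by [].
move=> u hu.
have [A [B [A0 AB uAB]]] := polar_support hu.
pose L j := iter j (@radial_laplacian R N) (polar u).
have aL j : annular u A B (L j).
  elim: j => [|j IH]; last exact: annular_laplacian.
  split => [|r w w1 r0 rAB]; first exact: (ray_smooth_polar u [::]).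
  exact: (uAB [::] r w w1 r0 rAB).
have e00 F : hyp_integral (fun r w => F r w ^+ 2) = @energy R N 0 F.
  by apply: eq_hyp_integral => r w _; rewrite expr0 divr1.
rewrite !e00.
have gap : (a + 1 / 64) * S * energy 2 (L 0) +
    (b + 1 / 64) * P * energy (2 * k) (L 0) <=
    energy 0 (L (h + p)%N) - ((N%:R - 1) / 2) ^+ (4 * p) * energy 0 (L h).
  rewrite k4; apply: (@energy_iter R N (fun j n => energy n (L j))) => //.
  - by move=> j n; exact: energy_ge0.
  - by rewrite addr_ge0// ltW.
  - by rewrite addr_ge0// ltW.
  - by move=> j; exact: (improved_poincare_rellich hu N0 A0 AB (aL j) N5).
  - move=> j; apply: (weighted_poincare hu N0 A0 AB (aL j)).
    exact: leq_trans N5.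
  - by move=> j n nN; exact: (weighted_rellich hu N0 A0 AB (aL j) nN).
rewrite mE; apply: le_trans gap.
pose E i := energy (2 * i) (L 0).
have E0 i : 0 <= E i := energy_ge0 _ _.
have -> : energy 2 (L 0) = E 1%N by [].
have -> : energy (2 * k) (L 0) = E k by [].
rewrite {1}kE big_ltn// big_nat_recr//= -kE eqxx.
set M := \sum_(_ <= _ < _) _.
rewrite -[hyp_integral _]/(E 1%N) -[hyp_integral _]/(E k).
have mid : M <= e * k'%:R * (E 1%N + E k).
  apply: (@le_trans _ _ (\sum_(2 <= i < k) e * (E 1%N + E k))); last first.
    by rewrite sumr_const_nat kE subSS subSS subn0 mulrAC mulr_natr.
  apply: ler_sum_nat => i /andP[i2 ik].
  rewrite gtn_eqF// ltn_eqF// ler_wpM2l ?(ltW e0)//.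
  apply: (energy_interpolation hu N0 A0 AB (aL 0%N)).
  by rewrite (ltnW i2) (ltnW ik).
have eS : e * k'%:R <= S / 64.
  by apply: le_trans ek _; rewrite ler_pM2r// ge_min lexx.
have eP : e * k'%:R <= P / 64.
  by apply: le_trans ek _; rewrite ler_pM2r// ge_min lexx orbT.
have := ler_wpM2r (E0 1%N) eS; have := ler_wpM2r (E0 k) eP.
move: mid; rewrite mulrDr.
by move: (E 1%N) (E k) (e * k'%:R) M => ? ? ? ?; lra.
Qed.
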